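(* Let $X,X_1,X_2,\dots$ be i.i.d. $d$-dimensional random vectors. Suppose $X$ has some absolutely continuous distribution (with respect to $d$-dimensional Lebesgue measure), and that $M_X(t)=\mathbb{E}[\exp(t^\top X)]<\infty$ for each $t\in\mathbb{R}^d$. Let $\gamma>0$, let $w_\gamma(t)=\exp(-\gamma\|t\|^2)$, and let $T_{n,\gamma}$ be the statistic defined in the context. Then $$\liminf_{n\to\infty}\frac{T_{n,\gamma}}n\ \ge\ \int_{\mathbb{R}^d}\left(R_X(t)M_X(t)-1\right)^2w_\gamma(t)\,dt$$ almost surely, where $R_X(t)=\mathrm{Re}\,\mathbb{E}[\exp(\mathrm{i}t^\top X)]$ is the real part of the characteristic function of $X$.
   Context: Let $\overline X_n=n^{-1}\sum_{j=1}^nX_j$ and $S_n=n^{-1}\sum_{j=1}^n(X_j-\overline X_n)(X_j-\overline X_n)^\top$ be the sample mean and the sample covariance matrix of $X_1,\dots,X_n$. For $n\ge d+1$ (assumed throughout) $S_n$ is invertible almost surely; $S_n^{-1/2}$ denotes the symmetric positive definite square root of $S_n^{-1}$, and $Y_{n,j}=S_n^{-1/2}(X_j-\overline X_n)$, $j=1,\dots,n$, are the scaled residuals. Put $$R_n(t)=\frac1n\sum_{j=1}^n\cos(t^\top Y_{n,j}),\quad M_n(t)=\frac1n\sum_{j=1}^n\exp(t^\top Y_{n,j}),\quad U_n(t)=\sqrt n\,(R_n(t)M_n(t)-1),\quad t\in\mathbb{R}^d,$$ and $T_{n,\gamma}=\int_{\mathbb{R}^d}U_n^2(t)\,w_\gamma(t)\,dt$.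 Here $\|\cdot\|$ is the Euclidean norm.
   Formalization: As stated the bound fails for non-standardized X (T is affine invariant, the right side is not); it is proved with R_X, M_X taken for the standardized vector Σ^{-1/2}(X−EX), and for X itself when EX=0 and Cov X is the identity. *)

(* Defs.v *)
From HB Require Import structures.
From mathcomp Require Import all_boot all_order all_algebra.
From mathcomp Require Import complex.
From mathcomp Require Import finmap.
From mathcomp Require Import all_classical all_reals all_analysis.

Set Implicit Arguments.
Unset Strict Implicit.
Unset Printing Implicit Defensive.

Import Order.TTheory GRing.Theory Num.Theory.
Import numFieldNormedType.Exports.

Local Open Scope classical_set_scope.
Local Open Scope ring_scope.

(* R^d as a measurable space, with the product (i.e. Borel) sigma-algebra;
   [cvec] is the passage to column vectors used for the linear algebra. *)
Notation Rd R d := (d.-tuple (measurableTypeR R)).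

Definition cvec (R : realType) (d : nat) (x : Rd R d) : 'cV[R]_d :=
  \col_i tnth x i.
Arguments cvec {R d} x.

Section lebesgue_step.
Context (R : realType) (n : nat).
Variable mu : {sigma_finite_measure set (Rd R n) -> \bar R}.

Definition cons_pair (p : measurableTypeR R * Rd R n) : Rd R n.+1 :=
  [tuple of p.1 :: p.2].

Definition uncons_pair (t : Rd R n.+1) : measurableTypeR R * Rd R n :=
  (thead t, [tuple of behead t]).

Lemma cons_pairK : cancel cons_pair uncons_pair.
Proof. by move=> [x t]; congr pair; exact: val_inj. Qed.

Lemma uncons_pairK : cancel uncons_pair cons_pair.
Proof. by move=> t; apply/val_inj; rewrite [in RHS](tuple_eta t). Qed.

Lemma measurable_cons_pair : measurable_fun setT cons_pair.
Proof. by apply: measurable_cons; [exact: measurable_fst|exact: measurable_snd]. Qed.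

Lemma measurable_uncons_pair : measurable_fun setT uncons_pair.
Proof.
apply: measurable_fun_pair; first exact: measurable_tnth.
exact: measurable_behead.
Qed.

Definition lebesgue_step : set (Rd R n.+1) -> \bar R :=
  pushforward (@lebesgue_measure R \x mu)%E cons_pair.

Let step0 : lebesgue_step set0 = 0%E.
Proof. by rewrite /lebesgue_step /pushforward preimage_set0 measure0. Qed.

Let step_ge0 A : (0 <= lebesgue_step A)%E.
Proof. by rewrite /lebesgue_step /pushforward; exact: measure_ge0. Qed.

Let step_sigma_additive : semi_sigma_additive lebesgue_step.
Proof.
move=> F mF tF mUF; rewrite /lebesgue_step /pushforward preimage_bigcup.
apply: measure_semi_sigma_additive.
- by move=> k; rewrite -[X in measurable X]setTI; exact: measurable_cons_pair.
- apply/trivIsetP => /= i j _ _ ij; rewrite -preimage_setI.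
  by move/trivIsetP : tF => /(_ _ _ _ _ ij) ->//; rewrite preimage_set0.
- rewrite -preimage_bigcup -[X in measurable X]setTI.
  exact: measurable_cons_pair.
Qed.

HB.instance Definition _ := isMeasure.Build _ _ _ lebesgue_step
  step0 step_ge0 step_sigma_additive.

Let step_sigma_finite : sigma_finite setT lebesgue_step.
Proof.
have /sigma_finiteP[F [TF ndF Foo]] := sigma_finiteT (@lebesgue_measure R).
have /sigma_finiteP[G [TG ndG Goo]] := sigma_finiteT mu.
exists (fun k => uncons_pair @^-1` (F k `*` G k)).
  rewrite -preimage_bigcup (_ : \bigcup_k _ = setT) ?preimage_setT//.
  apply/seteqP; split=> [//|[x y] _].
  have [i _ Fx] : (\bigcup_k F k) x by rewrite -TF.
  have [j _ Gy] : (\bigcup_k G k) y by rewrite -TG.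
  exists (maxn i j) => //; split => /=.
  - by move: Fx; apply/subsetPset/ndF; rewrite leq_maxl.
  - by move: Gy; apply/subsetPset/ndG; rewrite leq_maxr.
move=> k; have [mF Fk] := Foo k; have [mG Gk] := Goo k.
split.
  rewrite -[X in measurable X]setTI.
  by apply: measurable_uncons_pair => //; exact: measurableX.
rewrite /lebesgue_step /pushforward -comp_preimage.
rewrite (_ : _ \o _ = id); last by apply/funext => p; exact: cons_pairK.
by rewrite preimage_id product_measure1E// lte_mul_pinfty// ge0_fin_numE.
Qed.

HB.instance Definition _ := Measure_isSigmaFinite.Build _ _ _ lebesgue_step
  step_sigma_finite.

End lebesgue_step.

(* d-dimensional Lebesgue measure, as a d-fold product. *)
Fixpoint lebesgue (R : realType) (d : nat) :
    {sigma_finite_measure set (Rd R d) -> \bar R} :=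
  match d with
  | 0 => [the {sigma_finite_measure set (Rd R 0) -> \bar R} of
            \d_([tuple] : Rd R 0)]
  | d'.+1 => [the {sigma_finite_measure set (Rd R d'.+1) -> \bar R} of
            lebesgue_step (lebesgue R d')]
  end.

Section linear_algebra.
Context (R : realType) (d : nat).
Implicit Types (u v : 'cV[R]_d) (B S : 'M[R]_d).

Definition dotv u v : R := (u^T *m v) 0 0.

(* The Euclidean norm; the library norm on matrices is the sup norm. *)
Definition enorm u : R := Num.sqrt (dotv u u).

Definition posdefmx B : Prop :=
  B^T = B /\ forall u, u != 0 -> 0 < dotv u (B *m u).

(* S^(-1/2), the symmetric positive definite square root of S^-1. When S is
   singular there is no such root and the value is the junk value 0. *)
Definition invsqrtmx S : 'M[R]_d :=
  xget 0 [set B | posdefmx B /\ B *m B = invmx S].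

End linear_algebra.

Section test_statistic.
Context (R : realType) (d : nat).
(* A realization of the sample; its first n terms [x 0], ..., [x n.-1] play
   the role of X_1, ..., X_n. *)
Variables (x : nat -> 'cV[R]_d) (n : nat).

Definition sample_mean : 'cV[R]_d := n%:R^-1 *: \sum_(j < n) x j.

Definition sample_cov : 'M[R]_d :=
  n%:R^-1 *: \sum_(j < n) ((x j - sample_mean) *m (x j - sample_mean)^T).

Definition residual (j : nat) : 'cV[R]_d :=
  invsqrtmx sample_cov *m (x j - sample_mean).

Definition R_stat (t : 'cV[R]_d) : R :=
  n%:R^-1 * \sum_(j < n) cos (dotv t (residual j)).

Definition M_stat (t : 'cV[R]_d) : R :=
  n%:R^-1 * \sum_(j < n) expR (dotv t (residual j)).

Definition U_stat (t : 'cV[R]_d) : R :=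
  Num.sqrt n%:R * (R_stat t * M_stat t - 1).

Definition weight (gamma : R) (t : 'cV[R]_d) : R :=
  expR (- gamma * enorm t ^+ 2).

Definition T_stat (gamma : R) : \bar R :=
  (\int[lebesgue R d]_u (U_stat (cvec u) ^+ 2 * weight gamma (cvec u))%:E)%E.

End test_statistic.

Section population.
Context (dO : measure_display) (Omega : measurableType dO) (R : realType).
Variable P : probability Omega R.

Definition expectationC (f : Omega -> R[i]) : R[i] :=
  Complex (fine 'E_P[fun w => complex.Re (f w)])
          (fine 'E_P[fun w => complex.Im (f w)]).

(* exp (i theta) *)
Definition expi (theta : R) : R[i] := Complex (cos theta) (sin theta).

Variable d : nat.

Section characteristics.
Variable Z : Omega -> 'cV[R]_d.

Definition char_fun (t : 'cV[R]_d) : R[i] :=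
  expectationC (fun w => expi (dotv t (Z w))).

Definition R_fun (t : 'cV[R]_d) : R := complex.Re (char_fun t).

Definition M_fune (t : 'cV[R]_d) : \bar R :=
  ('E_P[fun w => expR (dotv t (Z w))])%E.

Definition M_fun (t : 'cV[R]_d) : R := fine (M_fune t).

Definition mean_vec : 'cV[R]_d :=
  \col_i fine ('E_P[fun w => Z w i ord0])%E.

Definition cov_mx : 'M[R]_d :=
  \matrix_(i, j) fine (covariance P (fun w => Z w i ord0) (fun w => Z w j ord0)).

(* Sigma^(-1/2) (Z - mu), with mu the mean and Sigma the covariance of Z.
   [T_stat] only depends on the sample through its scaled residuals, so the
   limit of T_n / n is a functional of the law of this standardized vector,
   which is the vector itself when mu = 0 and Sigma = I. *)
Definition standardize (w : Omega) : 'cV[R]_d :=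
  invsqrtmx cov_mx *m (Z w - mean_vec).

Definition limit_functional (gamma : R) : \bar R :=
  (\int[lebesgue R d]_u
     ((R_fun (cvec u) * M_fun (cvec u) - 1) ^+ 2
        * weight gamma (cvec u))%:E)%E.

End characteristics.

Definition mutually_independent (X : nat -> Omega -> Rd R d) : Prop :=
  forall (J : {fset nat}) (A : nat -> set (Rd R d)),
    (forall j, measurable (A j)) ->
    P (\bigcap_(j in [set` J]) (X j @^-1` A j)) =
    (\prod_(j <- J) P (X j @^-1` A j))%E.

Definition identically_distributed (X Y : {RV P >-> Rd R d}) : Prop :=
  forall A, measurable A -> distribution P X A = distribution P Y A.

End population.

(* Main.v *)
(* Writing [t . Y_nj = s_n . X_j + c_n] with [s_n = (S_n^(-1/2))^T t] and
   [c_n = - s_n . mean_n] turns [R_n t] and [M_n t] into averages of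
   [f (s_n . X_j + c_n)], for [f] the cosine or the exponential. All exponential
   moments of [X] are finite, so second moments are at hand everywhere and the
   strong law follows from pairwise uncorrelatedness alone: the variances along
   [n = k^2] are summable, and nonnegative summands interpolate between squares. Almost surely the averages converge
   for all rational [(s, c)] and, by a Lipschitz bound whose constant is itself an
   average, locally uniformly in [(s, c)]. Absolute continuity makes the
   covariance positive definite, hence [S_n^(-1/2)] converges to its population
   counterpart; so almost surely the integrands converge at every [t], and Fatou's
   lemma concludes. *)

Require Import Defs.
From HB Require Import structures.
From mathcomp Require Import all_boot all_order all_algebra.
From mathcomp Require Import complex.
From mathcomp Require Import finmap.
From mathcomp Require Import all_classical all_reals all_analysis.
From mathcomp Require Import spectral sesquilinear measurable_realfun.
From mathcomp Require Import ring lra zify.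
Set Implicit Arguments.
Unset Strict Implicit.
Unset Printing Implicit Defensive.
Import Order.TTheory GRing.Theory Num.Theory.
Import numFieldNormedType.Exports.
Local Open Scope classical_set_scope.
Local Open Scope ring_scope.

(** The scaled residuals of one sample are dependent, since each involves all observations through
    the sample mean and [S_n]; the strong law cannot be applied to them. It is applied with fixed
    parameters, and the exceptional null set has to be chosen before the parameters: these are
    afterwards read off the same sample, and Fatou's lemma in [t] needs one event that serves every
    [t]. Interpolating between squares requires monotone partial sums. Signed functions, such as the
    cosine or the coordinates, are made nonnegative by adding an integrable majorant whose own
    averages converge. The matrix square root is handled without following eigenvectors. It exists
    as a real polynomial in the matrix, interpolated on the spectrum and checked over the complex
    numbers; it is continuous by a trace inequality in which only the limiting root needs a
    quantitative lower bound. *)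

Section pointwise_limits.
Context {R : numFieldType} {T : Type} (F : set_system T) {FF : Filter F}.
Implicit Types (f g : T -> R) (a b : R).

Lemma cvg_addf f g a b : f x @[x --> F] --> a -> g x @[x --> F] --> b ->
  f x + g x @[x --> F] --> a + b.
Proof. by move=> fa gb; exact: (cvgD fa gb). Qed.

Lemma cvg_mulf f g a b : f x @[x --> F] --> a -> g x @[x --> F] --> b ->
  f x * g x @[x --> F] --> a * b.
Proof. by move=> fa gb; exact: (cvgM fa gb). Qed.

Lemma cvg_oppf f a : f x @[x --> F] --> a -> - f x @[x --> F] --> - a.
Proof. by move=> fa; exact: (cvgN fa). Qed.

Lemma cvg_subf f g a b : f x @[x --> F] --> a -> g x @[x --> F] --> b ->
  f x - g x @[x --> F] --> a - b.
Proof. by move=> fa gb; apply: cvg_addf => //; exact: cvg_oppf. Qed.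

Lemma cvg_sumf (I : Type) (r : seq I) (P : pred I) (f : I -> T -> R) (a : I -> R) :
  (forall i, f i x @[x --> F] --> a i) ->
  \sum_(i <- r | P i) f i x @[x --> F] --> \sum_(i <- r | P i) a i.
Proof.
move=> fa; elim: r => [|i r ih].
  by rewrite big_nil; under eq_fun do rewrite big_nil; exact: cvg_cst.
rewrite big_cons; under eq_fun do rewrite big_cons.
by case: (P i) => //; exact: cvg_addf.
Qed.

Lemma cvg_prodf (I : Type) (r : seq I) (P : pred I) (f : I -> T -> R) (a : I -> R) :
  (forall i, f i x @[x --> F] --> a i) ->
  \prod_(i <- r | P i) f i x @[x --> F] --> \prod_(i <- r | P i) a i.
Proof.
move=> fa; elim: r => [|i r ih].
  by rewrite big_nil; under eq_fun do rewrite big_nil; exact: cvg_cst.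
rewrite big_cons; under eq_fun do rewrite big_cons.
by case: (P i) => //; exact: cvg_mulf.
Qed.

End pointwise_limits.

(** * Averages along squares and the series of inverse squares *)

Section squares.
Variable R : realType.

Lemma exists_sqrt_bracket n : exists j, (j.+1 ^ 2 <= n.+1 < j.+2 ^ 2)%N.
Proof.
elim: n => [|n [j /andP[j1 j2]]]; first by exists 0%N.
have [lt|ge] := ltnP n.+2 (j.+2 ^ 2); first by exists j; rewrite lt (leq_trans j1).
exists j.+1; rewrite ge /=; apply: leq_ltn_trans j2 _.
by rewrite ltn_exp2r.
Qed.

(** If [(j+1)^2 <= n+1 < (j+2)^2], monotonicity traps [S (n+1) / (n+1)] between the averages at
    these two squares, up to a factor that is the ratio of the squares and tends to 1. *)
Lemma cvg_avg_of_squares (S : nat -> R) (mu : R) :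
  (forall n, 0 <= S n) -> (forall m n, (m <= n)%N -> S m <= S n) ->
  S (k.+1 ^ 2)%N / (k.+1 ^ 2)%:R @[k --> \oo] --> mu ->
  S n / n%:R @[n --> \oo] --> mu.
Proof.
move=> S0 Smono Smu; rewrite -cvg_shiftS.
have [j jP] := choice exists_sqrt_bracket.
have joo : j n @[n --> \oo] --> \oo.
  apply/cvgnyPge => A; near=> n.
  have /andP[_ nj] := jP n.
  have : (A.+2 ^ 2 < (j n).+2 ^ 2)%N.
    by apply: leq_ltn_trans nj; apply: leqW; near: n; exact: nbhs_infty_ge.
  by rewrite ltn_exp2r//; lia.
pose a k := S (k.+1 ^ 2)%N / (k.+1 ^ 2)%:R.
(* This is [((k+2) / (k+1))^2], the ratio of consecutive squares. *)
pose r k : R := (1 + k.+1%:R^-1) ^+ 2.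
have r1 : r k @[k --> \oo] --> (1 : R).
  rewrite -[X in _ --> X](expr1n _ 2) /r; under eq_fun do rewrite expr2.
  have h : (1 + k.+1%:R^-1 : R) @[k --> \oo] --> (1 : R).
    by rewrite -[X in _ --> X]addr0; apply: cvg_addf; [exact: cvg_cst|exact: (@cvg_harmonic R)].
  by rewrite expr2; apply: cvg_mulf.
have r0 k : 0 < r k by rewrite exprn_gt0// addr_gt0.
have rE k : r k * (k.+1 ^ 2)%:R = (k.+2 ^ 2)%:R.
  by rewrite /r !natrX -exprMn mulrDl mul1r mulVf// -[k.+2%:R]natr1.
have sq0 k : (0 : R) < (k.+1 ^ 2)%:R by rewrite ltr0n expn_gt0.
apply: (@squeeze_cvgr _ _ _ _ (fun n => a (j n) / r (j n))
    (fun n => a (j n).+1 * r (j n))).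
- near=> n; have /andP[n1 n2] := jP n; apply/andP; split.
    rewrite /a -mulrA -invfM [_ * r _]mulrC rE.
    apply: (@le_trans _ _ (S n.+1 / ((j n).+2 ^ 2)%:R)).
      by rewrite ler_wpM2r ?invr_ge0 ?ler0n//; apply: Smono.
    by rewrite ler_wpM2l// lef_pV2 ?posrE ?ltr0n ?expn_gt0// ler_nat ltnW.
  have -> : a (j n).+1 * r (j n) = S ((j n).+2 ^ 2)%N / ((j n).+1 ^ 2)%:R.
    rewrite /a -(rE (j n)); move: (r0 (j n)) (sq0 (j n)).
    move: (r _) (_%:R : R) => x y x0 y0.
    by field; rewrite !gt_eqF.
  apply: (@le_trans _ _ (S n.+1 / ((j n).+1 ^ 2)%:R)).
    by rewrite ler_wpM2l// lef_pV2 ?posrE ?ltr0n ?expn_gt0// ler_nat.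
  by rewrite ler_wpM2r ?invr_ge0 ?ler0n//; apply: Smono; exact: ltnW.
- rewrite -[X in _ --> X]divr1; apply: cvg_mulf.
    exact: (cvg_comp _ _ joo Smu).
  by apply: cvgV; rewrite ?oner_eq0//; exact: (cvg_comp _ _ joo r1).
- rewrite -[X in _ --> X]mulr1; apply: cvg_mulf.
    have Smu' : a k.+1 @[k --> \oo] --> mu by rewrite (cvg_shiftS a).
    exact: (cvg_comp _ _ joo Smu').
  exact: (cvg_comp _ _ joo r1).
Unshelve. all: by end_near.
Qed.

Lemma sum_inv_sq_le n : \sum_(0 <= k < n) (k.+1%:R ^- 2 : R) <= 2.
Proof.
(* Strengthened for the induction: [1/(k+1)^2 <= 2/(k+1) - 2/(k+2)] telescopes. *)
suff : \sum_(0 <= k < n) (k.+1%:R ^- 2 : R) <= 2 - 2 / n.+1%:R.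
  by move=> h; apply: le_trans h _; rewrite gerBl divr_ge0 ?ler0n.
elim: n => [|n ih]; first by rewrite big_nil invr1; lra.
rewrite big_nat_recr//=; apply: le_trans (lerD ih (lexx _)) _.
rewrite -[n.+2%:R]natr1 -addrA lerD2l.
have : (1 : R) <= n.+1%:R by rewrite ler1n.
set x : R := n.+1%:R => x1.
rewrite -subr_ge0.
have -> : - (2 / (x + 1)) - (- (2 / x) + x ^- 2) = (x - 1) / (x ^+ 2 * (x + 1)).
  by field; apply/andP; split; apply: lt0r_neq0; lra.
by rewrite divr_ge0//; [lra|rewrite mulr_ge0 ?sqr_ge0//; lra].
Qed.

End squares.

(** * Real expectations and the strong law for uncorrelated nonnegative variables *)

Section expectation.
Context (dO : measure_display) (Omega : measurableType dO) (R : realType).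
Variable P : probability Omega R.
Implicit Types f g : Omega -> R.

Definition integrableR f := P.-integrable setT (EFin \o f).
Definition mean f : R := \int[P]_w f w.

Lemma integrableR_measurable f : integrableR f -> measurable_fun setT f.
Proof. by move=> /integrableP[/measurable_EFinP]. Qed.

Lemma integrableR_cst (k : R) : integrableR (fun=> k).
Proof. exact: finite_measure_integrable_cst. Qed.

Lemma integrableRD f g : integrableR f -> integrableR g ->
  integrableR (fun w => f w + g w).
Proof. by move=> fi gi; exact: (integrableD measurableT fi gi). Qed.

Lemma integrableRZ k f : integrableR f -> integrableR (fun w => k * f w).
Proof. by move=> fi; exact: (integrableZl measurableT k fi). Qed.

Lemma integrableRB f g : integrableR f -> integrableR g ->
  integrableR (fun w => f w - g w).
Proof. by move=> fi gi; exact: (integrableB measurableT fi gi). Qed.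

Lemma integrableR_sum (I : Type) (r : seq I) (Q : pred I) (f : I -> Omega -> R) :
  (forall i, integrableR (f i)) -> integrableR (fun w => \sum_(i <- r | Q i) f i w).
Proof.
move=> fi; elim: r => [|i r ih].
  by under eq_fun do rewrite big_nil; exact: integrableR_cst.
by under eq_fun do rewrite big_cons; case: (Q i) => //; exact: integrableRD.
Qed.

Lemma le_integrableR f g : measurable_fun setT f -> (forall w, `|f w| <= g w) ->
  integrableR g -> integrableR f.
Proof.
move=> mf fg; apply: le_integrable => //; first exact/measurable_EFinP.
by move=> w _ /=; rewrite lee_fin (le_trans (fg w))// ler_norm.
Qed.

Lemma EFin_mean f : integrableR f -> (mean f)%:E = (\int[P]_w (f w)%:E)%E.
Proof. by move=> fi; rewrite /mean /Rintegral fineK//; exact: integrable_fin_num. Qed.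

Lemma mean_cst k : mean (fun=> k) = k.
Proof. by rewrite /mean Rintegral_cst//= probability_setT mulr1. Qed.

Lemma meanD f g : integrableR f -> integrableR g ->
  mean (fun w => f w + g w) = mean f + mean g.
Proof. by move=> fi gi; rewrite /mean RintegralD. Qed.

Lemma meanB f g : integrableR f -> integrableR g ->
  mean (fun w => f w - g w) = mean f - mean g.
Proof. by move=> fi gi; rewrite /mean RintegralB. Qed.

Lemma meanZ k f : integrableR f -> mean (fun w => k * f w) = k * mean f.
Proof. by move=> fi; rewrite /mean RintegralZl. Qed.

Lemma mean_sum (I : Type) (r : seq I) (Q : pred I) (f : I -> Omega -> R) :
  (forall i, integrableR (f i)) ->
  mean (fun w => \sum_(i <- r | Q i) f i w) = \sum_(i <- r | Q i) mean (f i).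
Proof.
move=> fi; elim: r => [|i r ih].
  by rewrite big_nil; under eq_fun do rewrite big_nil; exact: mean_cst.
rewrite big_cons -ih; under eq_fun do rewrite big_cons.
case: (Q i) => //; apply: meanD => //; exact: integrableR_sum.
Qed.

Lemma le_mean f g : integrableR f -> integrableR g -> (forall w, f w <= g w) ->
  mean f <= mean g.
Proof. by move=> fi gi fg; apply: le_Rintegral. Qed.

Lemma mean_ge0 f : (forall w, 0 <= f w) -> 0 <= mean f.
Proof. by move=> f0; apply: Rintegral_ge0. Qed.

Lemma le_norm_mean f : integrableR f -> `|mean f| <= mean (fun w => `|f w|).
Proof. by move=> fi; apply: le_normr_Rintegral. Qed.

Lemma integrableR_abs f : integrableR f -> integrableR (fun w => `|f w|).
Proof.
move=> fi; apply: le_integrable (fi) => //.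
  by apply/measurable_EFinP; apply: measurableT_comp => //; exact: integrableR_measurable.
by move=> w _ /=; rewrite normr_id.
Qed.

(** The whole series has expectation at most [c], so it is almost surely finite and its terms
    vanish. This replaces Chebyshev's inequality and Borel-Cantelli. *)
Lemma ae_cvg0_of_summable (f : nat -> Omega -> R) (c : R) :
  (forall k w, 0 <= f k w) -> (forall k, integrableR (f k)) ->
  (forall n, \sum_(0 <= k < n) mean (f k) <= c) ->
  {ae P, forall w, f k w @[k --> \oo] --> (0 : R)}.
Proof.
move=> f0 fi fc.
pose F w := (\sum_(0 <= k <oo) (f k w)%:E)%E.
have mf k : measurable_fun setT (fun w => (f k w)%:E).
  by apply/measurable_EFinP; exact: integrableR_measurable.
have F0 w : (0 <= F w)%E by apply: nneseries_ge0 => k _ _; rewrite lee_fin.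
have iF : P.-integrable setT F.
  apply/integrableP; split.
    by apply: ge0_emeasurable_sum => // k w _ _; rewrite lee_fin.
  under eq_integral do rewrite gee0_abs//.
  rewrite integral_nneseries//; last by move=> k w _; rewrite lee_fin.
  apply: (@le_lt_trans _ _ c%:E); last exact: ltry.
  apply: lime_le.
    by apply: is_cvg_nneseries => k _ _; apply: integral_ge0 => w _; rewrite lee_fin.
  apply: nearW => n.
  under eq_bigr do rewrite -(EFin_mean (fi _)).
  by rewrite sumEFin lee_fin.
apply: filterS (integrable_ae measurableT iF) => w /(_ I) Ffin.
apply: cvg_series_cvg_0.
apply: nondecreasing_is_cvgn.
  by apply: nondecreasing_series => n _ _; exact: f0.
exists (fine (F w)) => _ [n _ <-].
rewrite -lee_fin fineK// /series/= -sumEFin.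
by apply: nneseries_lim_ge => k _; rewrite lee_fin.
Qed.

Lemma ae_cvg_avg_uncorrelated (Z : nat -> Omega -> R) (mu m2 : R) :
  (forall i w, 0 <= Z i w) -> (forall i, integrableR (Z i)) ->
  (forall i j, integrableR (fun w => Z i w * Z j w)) ->
  (forall i, mean (Z i) = mu) ->
  (forall i j, mean (fun w => Z i w * Z j w) = if i == j then m2 else mu ^+ 2) ->
  {ae P, forall w, n%:R^-1 * (\sum_(j < n) Z j w) @[n --> \oo] --> mu}.
Proof.
move=> Z0 Zi ZZi EZ EZZ.
pose V i w := Z i w - mu.
have VVE i j : (fun w => V i w * V j w) =
    (fun w => Z i w * Z j w - (mu * Z i w + mu * Z j w - mu ^+ 2)).
  by apply/funext => w; rewrite /V; ring.
have VVi1 i j : integrableR (fun w => mu * Z i w + mu * Z j w - mu ^+ 2).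
  by apply: integrableRB (integrableR_cst _); apply: integrableRD; exact: integrableRZ.
have VVi i j : integrableR (fun w => V i w * V j w).
  by rewrite VVE; apply: integrableRB.
have EVV i j : mean (fun w => V i w * V j w) = if i == j then m2 - mu ^+ 2 else 0.
  rewrite VVE meanB// meanB; [|by apply: integrableRD; exact: integrableRZ
    |exact: integrableR_cst].
  rewrite meanD; [|exact: integrableRZ|exact: integrableRZ].
  by rewrite mean_cst !meanZ// !EZ EZZ; case: ifP => _; ring.
set v := m2 - mu ^+ 2 in EVV.
have v0 : 0 <= v.
  have := EVV 0%N 0%N; rewrite eqxx => <-.
  by apply: mean_ge0 => w; rewrite -expr2 sqr_ge0.
pose W n w := \sum_(i < n) V i w.
have WWE n : (fun w => W n w ^+ 2) = (fun w => \sum_(i < n) \sum_(j < n) V i w * V j w).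
  apply/funext => w; rewrite expr2 /W mulr_suml.
  by apply: eq_bigr => i _; rewrite mulr_sumr.
have WWi n : integrableR (fun w => W n w ^+ 2).
  by rewrite WWE; do 2 apply: integrableR_sum => ?; exact: VVi.
have EWW n : mean (fun w => W n w ^+ 2) = n%:R * v.
  rewrite WWE mean_sum; last by move=> i; apply: integrableR_sum => j; exact: VVi.
  rewrite (eq_bigr (fun=> v)); first by rewrite sumr_const card_ord mulr_natl.
  move=> i _; rewrite mean_sum// (bigD1 i)//= EVV eqxx big1 ?addr0// => j ji.
  by rewrite EVV eq_sym (negPf ji : (nat_of_ord j == i) = false).
(* The squared deviation from [mu] of the average over [(k+1)^2] terms; its mean is
   [v / (k+1)^2]. *)
pose f k w := (k.+1%:R ^- 4) * W (k.+1 ^ 2)%N w ^+ 2.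
have fi k : integrableR (f k) by exact: integrableRZ.
have f0 k w : 0 <= f k w.
  by rewrite mulr_ge0 ?sqr_ge0// invr_ge0 exprn_ge0.
have Ef k : mean (f k) = v * k.+1%:R ^- 2.
  rewrite meanZ// EWW natrX.
  have : (k.+1%:R : R) != 0 by rewrite pnatr_eq0.
  by move: (k.+1%:R : R) => x x0; field.
have := ae_cvg0_of_summable f0 fi (c := v * 2).
have h n : \sum_(0 <= k < n) mean (f k) <= v * 2.
  under eq_bigr do rewrite Ef.
  by rewrite -mulr_sumr ler_wpM2l// sum_inv_sq_le.
move=> /(_ h); apply: filterS => w fw.
under eq_fun do rewrite mulrC.
apply: (@cvg_avg_of_squares _ (fun n => \sum_(j < n) Z j w)).
- by move=> n; apply: sumr_ge0.
- move=> m n mn; rewrite -(subnKC mn) big_split_ord/= lerDl.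
  by apply: sumr_ge0.
- have WE n : \sum_(j < n) Z j w = W n w + n%:R * mu.
    by rewrite /W big_split/= sumr_const card_ord mulNrn mulr_natl subrK.
  have sq0 k : ((k.+1 ^ 2)%:R : R) != 0 by rewrite pnatr_eq0 expn_eq0.
  rewrite (_ : (fun k => _) = fun k => W (k.+1 ^ 2)%N w / (k.+1 ^ 2)%:R + mu); last first.
    by apply/funext => k; rewrite WE mulrDl mulrAC divff// mul1r.
  rewrite -[X in _ --> X]add0r; apply: cvg_addf; last exact: cvg_cst.
  apply: norm_cvg0.
  have := cvg_comp _ _ fw (@sqrt_continuous R 0); rewrite sqrtr0.
  apply: cvg_trans; apply: near_eq_cvg; apply: nearW => k /=.
  rewrite /f -sqrtr_sqr; congr Num.sqrt; rewrite natrX.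
  have : (k.+1%:R : R) != 0 by rewrite pnatr_eq0.
  by move: (k.+1%:R : R) => x x0; field.
Qed.

End expectation.

(** * Equality in law, independence, and the strong law for nonnegative functions *)

Section iid.
Context (dO : measure_display) (Omega : measurableType dO) (R : realType).
Variables (P : probability Omega R) (d : nat).

Lemma ge0_integral_ident (X Y : {RV P >-> Rd R d}) (g : Rd R d -> \bar R) :
  identically_distributed X Y -> measurable_fun setT g -> (forall x, 0 <= g x)%E ->
  (\int[P]_w g (X w) = \int[P]_w g (Y w))%E.
Proof.
move=> XY mg g0.
have -> : (\int[P]_w g (X w) = \int[distribution P X]_x g x)%E.
  by rewrite ge0_integral_distribution.
have -> : (\int[P]_w g (Y w) = \int[distribution P Y]_x g x)%E.
  by rewrite ge0_integral_distribution.
by apply: eq_measure_integral => A mA _; exact: XY.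
Qed.

Lemma independent_pair (Xs : nat -> {RV P >-> Rd R d}) i j A B :
  mutually_independent P (fun j => Xs j : Omega -> Rd R d) -> i != j ->
  measurable A -> measurable B ->
  P (Xs i @^-1` A `&` Xs j @^-1` B) = (P (Xs i @^-1` A) * P (Xs j @^-1` B))%E.
Proof.
move=> ind ij mA mB.
pose AB k := if k == i then A else B.
have ji : (j == i) = false by rewrite eq_sym (negPf ij).
have := ind [fset i; j]%fset AB; rewrite big_fsetU1 ?inE//= big_seq_fset1.
rewrite /AB eqxx ji => <-; last by move=> k; case: ifP.
congr (P _); apply/seteqP; split => w /=.
  by move=> [wA wB] k /=; rewrite !inE => /orP[] /eqP ->; rewrite ?eqxx ?ji.
move=> h; split; have := h i; have := h j; rewrite /= !inE !eqxx ?orbT ?ji.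
  by move=> _ /(_ isT).
by move=> /(_ isT).
Qed.

(** Independence of events says that the joint law agrees with the product law on rectangles, hence
    everywhere, and Tonelli factorizes the integral. Nonnegativity allows this before the product is
    known to be integrable. *)
Lemma ge0_integralM_indep (Xs : nat -> {RV P >-> Rd R d}) i j (f g : Rd R d -> R) :
  mutually_independent P (fun j => Xs j : Omega -> Rd R d) -> i != j ->
  measurable_fun setT f -> measurable_fun setT g ->
  (forall x, 0 <= f x) -> (forall x, 0 <= g x) ->
  (\int[P]_w (f (Xs i w) * g (Xs j w))%:E =
   \int[P]_w (f (Xs i w))%:E * \int[P]_w (g (Xs j w))%:E)%E.
Proof.
move=> ind ij mf mg f0 g0.
pose XY w := (Xs i w, Xs j w).
have mXY : measurable_fun setT XY by apply: measurable_fun_pair.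
pose XYm : {RV P >-> (Rd R d * Rd R d)%type} := HB.pack XY (isMeasurableFun.Build _ _ _ _ XY mXY).
pose h (z : Rd R d * Rd R d) := (f z.1 * g z.2)%:E.
have mh : measurable_fun setT h.
  by apply/measurable_EFinP; apply: measurable_funM; apply: measurableT_comp.
have h0 z : (0 <= h z)%E by rewrite lee_fin mulr_ge0.
transitivity (\int[P]_w (h \o XYm) w)%E => //.
rewrite -ge0_integral_distribution//.
rewrite (eq_measure_integral (distribution P (Xs i) \x distribution P (Xs j))%E); last first.
  move=> A mA _; apply/esym.
  apply: (product_measure_unique (m' := distribution P XYm)) => // B C mB mC.
  exact: independent_pair.
rewrite fubini_tonelli1//.
have mfE : measurable_fun setT (EFin \o f) by apply/measurable_EFinP.
have mgE : measurable_fun setT (EFin \o g) by apply/measurable_EFinP.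
have ge0g : (0 <= \int[distribution P (Xs j)]_y (g y)%:E)%E.
  by apply: integral_ge0 => y _; rewrite lee_fin.
rewrite (eq_integral (fun x => (f x)%:E * \int[distribution P (Xs j)]_y (g y)%:E))%E; last first.
  move=> x _; rewrite /fubini_F /h/=; under eq_integral do rewrite EFinM.
  by rewrite ge0_integralZl// ?lee_fin// => y _; rewrite lee_fin.
rewrite ge0_integralZr//; last by move=> x _; rewrite lee_fin.
by rewrite !ge0_integral_distribution// => y; rewrite lee_fin.
Qed.

Lemma integrableR_ge0_fin (f : Omega -> R) (r : R) : measurable_fun setT f ->
  (forall w, 0 <= f w) -> (\int[P]_w (f w)%:E = r%:E)%E ->
  integrableR P f /\ mean P f = r.
Proof.
move=> mf f0 fr; split; last by rewrite /mean /Rintegral fr.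
apply/integrableP; split; first exact/measurable_EFinP.
under eq_integral => w _ do rewrite /= ger0_norm//.
by rewrite fr ltry.
Qed.

Variables (X : {RV P >-> Rd R d}) (Xs : nat -> {RV P >-> Rd R d}).
Hypothesis Xs_indep : mutually_independent P (fun j => Xs j : Omega -> Rd R d).
Hypothesis Xs_ident : forall j, identically_distributed (Xs j) X.

Lemma ae_cvg_avg_iid_ge0 (g : Rd R d -> R) : measurable_fun setT g ->
  (forall x, 0 <= g x) -> integrableR P (g \o X) ->
  integrableR P (fun w => g (X w) ^+ 2) ->
  {ae P, forall w, n%:R^-1 * (\sum_(j < n) g (Xs j w)) @[n --> \oo] --> mean P (g \o X)}.
Proof.
move=> mg g0 gi g2i.
have mgX j : measurable_fun setT (g \o Xs j) by apply: measurableT_comp.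
have fin j := integrableR_ge0_fin (mgX j) (fun w => g0 (Xs j w)).
have EgX j : integrableR P (g \o Xs j) /\ mean P (g \o Xs j) = mean P (g \o X).
  apply: fin; rewrite EFin_mean//.
  apply: (ge0_integral_ident (g := EFin \o g) (Xs_ident j)).
    exact/measurable_EFinP.
  by move=> x; rewrite lee_fin.
have ggP i j : integrableR P (fun w => g (Xs i w) * g (Xs j w)) /\
    mean P (fun w => g (Xs i w) * g (Xs j w)) =
    if i == j then mean P (fun w => g (X w) ^+ 2) else mean P (g \o X) ^+ 2.
  apply: integrableR_ge0_fin.
  - exact: (measurable_funM (mgX i) (mgX j)).
  - by move=> w; rewrite mulr_ge0.
  have [<-|ij] := eqVneq i j.
    rewrite EFin_mean//.
    apply: (ge0_integral_ident (g := fun x => (g x * g x)%:E) (Xs_ident i)).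
      by apply/measurable_EFinP; exact: measurable_funM.
    by move=> x; rewrite lee_fin mulr_ge0.
  rewrite (ge0_integralM_indep Xs_indep ij mg mg g0 g0) expr2 EFinM.
  congr (_ * _)%E; [rewrite -(EgX i).2|rewrite -(EgX j).2].
    by rewrite EFin_mean//; exact: (EgX i).1.
  by rewrite EFin_mean//; exact: (EgX j).1.
refine (@ae_cvg_avg_uncorrelated _ _ _ _ (fun j => g \o Xs j) _
  (mean P (fun w => g (X w) ^+ 2)) _ _ _ _ _) => [i w|i|i j|i|i j].
- exact: g0.
- exact: (EgX i).1.
- exact: (ggP i j).1.
- exact: (EgX i).2.
- exact: (ggP i j).2.
Qed.

End iid.

(** * Exponential envelopes and dependence on affine parameters *)

Section envelope.
Context (R : realType) (d : nat).
Implicit Types (s : 'cV[R]_d) (x : Rd R d) (K c : R).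

Definition norm1 x : R := \sum_(i < d) `|tnth x i|.

(** One family dominates everything that is averaged: the summand [1] absorbs the constant term of
    [affine], and products of envelopes are again envelopes. *)
Definition envelope K x : R := expR (K * (1 + norm1 x)).

Definition affine s c x : R := dotv s (cvec x) + c.

Lemma dotvE s u : dotv s u = \sum_(i < d) s i 0 * u i 0.
Proof. by rewrite /dotv mxE; apply: eq_bigr => i _; rewrite mxE. Qed.

Lemma affineE s c x : affine s c x = \sum_(i < d) s i 0 * tnth x i + c.
Proof. by rewrite /affine dotvE; congr (_ + _); apply: eq_bigr => i _; rewrite mxE. Qed.

Lemma norm1_ge0 x : 0 <= norm1 x.
Proof. exact: sumr_ge0. Qed.

Lemma envelope_ge0 K x : 0 <= envelope K x.
Proof. exact: expR_ge0. Qed.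

Lemma measurable_norm1 : measurable_fun setT norm1.
Proof.
apply: measurable_sum => i; apply: measurableT_comp => //.
exact: measurable_tnth.
Qed.

Lemma measurable_envelope K : measurable_fun setT (envelope K).
Proof.
apply: (measurableT_comp (@measurable_expR R)).
apply: measurable_funM => //; apply: measurable_funD => //.
exact: measurable_norm1.
Qed.

Lemma measurable_affine s c : measurable_fun setT (affine s c).
Proof.
rewrite (_ : affine s c = fun x => \sum_(i < d) s i 0 * tnth x i + c).
  apply: measurable_funD => //; apply: measurable_sum => i.
  by apply: measurable_funM => //; exact: measurable_tnth.
by apply/funext => x; exact: affineE.
Qed.

Lemma norm_affine_le s c K x : (forall i, `|s i 0| <= K) -> `|c| <= K ->
  `|affine s c x| <= K * (1 + norm1 x).
Proof.
move=> sK cK; rewrite affineE (le_trans (ler_normD _ _))// addrC mulrDr mulr1.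
rewrite lerD// (le_trans (ler_norm_sum _ _ _))// /norm1 mulr_sumr.
by apply: ler_sum => i _; rewrite normrM ler_wpM2r.
Qed.

Lemma affineB s s' c c' x : affine s c x - affine s' c' x = affine (s - s') (c - c') x.
Proof.
rewrite !affineE opprD addrACA -sumrB; congr (_ + _).
by apply: eq_bigr => i _; rewrite !mxE mulrBl.
Qed.

(** A Lipschitz condition with exponential weight, weak enough to hold for [expR] as well as for
    [cos]. *)
Definition exp_lipschitz (f : R -> R) :=
  forall a b, `|f a - f b| <= `|a - b| * expR (`|a| + `|b|).

(** In the rate [2 * K + 1], each of the two arguments of [f] contributes [K] to the weight; the
    remaining [1] absorbs the factor [1 + norm1 x] from the difference of the arguments. *)
Lemma exp_lipschitz_affine (f : R -> R) s s' c c' K delta x :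
  exp_lipschitz f ->
  (forall i, `|s i 0| <= K) -> (forall i, `|s' i 0| <= K) -> `|c| <= K -> `|c'| <= K ->
  (forall i, `|s i 0 - s' i 0| <= delta) -> `|c - c'| <= delta ->
  `|f (affine s c x) - f (affine s' c' x)| <= delta * envelope (2 * K + 1) x.
Proof.
move=> fL sK s'K cK c'K sd cd.
have d0 : 0 <= delta by apply: le_trans cd.
apply: le_trans (fL _ _) _.
have n1 : 0 <= norm1 x := norm1_ge0 x.
have h1 : `|affine s c x - affine s' c' x| <= delta * (1 + norm1 x).
  by rewrite affineB; apply: norm_affine_le => // i; rewrite !mxE.
apply: (@le_trans _ _ (delta * (1 + norm1 x) * expR (2 * K * (1 + norm1 x)))).
  apply: ler_pM; rewrite ?expR_ge0//.
  rewrite ler_expR -mulrA mulr_natl mulr2n lerD//; exact: norm_affine_le.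
rewrite -mulrA ler_wpM2l// /envelope [(_ + 1) * _]mulrDl mul1r expRD mulrC.
rewrite ler_wpM2l ?expR_ge0//.
by apply: le_trans (expR_ge1Dx _); rewrite lerDr.
Qed.

Lemma exp_lipschitz_expR : exp_lipschitz expR.
Proof.
have aux (a b : R) : a <= b -> `|expR a - expR b| <= `|a - b| * expR (`|a| + `|b|).
  move=> ab; rewrite distrC [(`|a - b|)]distrC.
  have -> : `|expR b - expR a| = expR b - expR a by rewrite ger0_norm// subr_ge0 ler_expR.
  have -> : `|b - a| = b - a by rewrite ger0_norm// subr_ge0.
  have -> : expR b - expR a = (1 - expR (a - b)) * expR b.
    by rewrite mulrBl mul1r -expRD subrK.
  apply: ler_pM; rewrite ?expR_ge0//.
  - by rewrite subr_ge0 -[leRHS]expR0 ler_expR subr_le0.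
  - by have := expR_ge1Dx (a - b); lra.
  - by rewrite ler_expR; have := normr_ge0 a; have := ler_norm b; lra.
move=> a b; have [ab|/ltW ba] := leP a b; first exact: aux.
by rewrite distrC [(`|a - b|)]distrC [(`|a| + _)]addrC; exact: aux.
Qed.

Lemma exp_lipschitz_cos : exp_lipschitz cos.
Proof.
have aux (a b : R) : a <= b -> `|cos a - cos b| <= `|a - b|.
  move=> ab; have [|c _ h] := @MVT_segment R cos (fun t => - sin t) a b ab.
    by apply: continuous_subspaceT => x; exact: continuous_cos.
  by rewrite distrC h normrM normrN [(`|a - b|)]distrC ler_piMl// sin_max.
move=> a b; apply: (@le_trans _ _ `|a - b|).
  by have [ab|/ltW ba] := leP a b; [|rewrite distrC [leRHS]distrC]; exact: aux.
by rewrite ler_peMr// -[leLHS]expR0 ler_expR addr_ge0.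
Qed.

Lemma rat_approx (x e : R) : 0 < e -> exists q : rat, `|ratr q - x| <= e.
Proof.
move=> e0; have [|q] := @rat_in_itvoo R (x - e) (x + e); first by lra.
by rewrite in_itv/= => /andP[q1 q2]; exists q; rewrite ler_norml; lra.
Qed.

End envelope.

Section avg.
Variable R : realType.
Implicit Types f g : nat -> R.

Definition avg n f : R := n%:R^-1 * \sum_(j < n) f j.

Lemma avgB n f g : avg n (fun j => f j - g j) = avg n f - avg n g.
Proof. by rewrite /avg sumrB mulrBr. Qed.

Lemma avgD n f g : avg n (fun j => f j + g j) = avg n f + avg n g.
Proof. by rewrite /avg big_split mulrDr. Qed.

Lemma avgZ n k f : avg n (fun j => k * f j) = k * avg n f.
Proof. by rewrite /avg -mulr_sumr mulrCA. Qed.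

Lemma le_avg n f g : (forall j, f j <= g j) -> avg n f <= avg n g.
Proof. by move=> fg; rewrite ler_wpM2l ?invr_ge0 ?ler0n// ler_sum. Qed.

Lemma le_norm_avg n f : `|avg n f| <= avg n (fun j => `|f j|).
Proof.
rewrite /avg normrM ger0_norm ?invr_ge0 ?ler0n//.
by rewrite ler_wpM2l ?invr_ge0 ?ler0n//; exact: ler_norm_sum.
Qed.

End avg.

(** * Strong law for functions dominated by an envelope *)

Section law_of_large_numbers.
Context (dO : measure_display) (Omega : measurableType dO) (R : realType).
Variables (P : probability Omega R) (d : nat) (X : {RV P >-> Rd R d}).
Hypothesis M_finite : forall t : 'cV[R]_d, (M_fune P (cvec \o X) t < +oo)%E.

Lemma integrableR_exp_dotv t : integrableR P (fun w => expR (dotv t (cvec (X w)))).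
Proof.
have mf : measurable_fun setT (fun w => expR (dotv t (cvec (X w)))).
  apply: (measurableT_comp (@measurable_expR R)).
  under eq_fun do rewrite -[dotv _ _]addr0 -/(affine _ _ _).
  by apply: (measurableT_comp (measurable_affine t 0)).
apply/integrableP; split; first exact/measurable_EFinP.
have := M_finite t; rewrite /M_fune unlock.
by under eq_integral do rewrite -[X in X%:E]ger0_norm ?expR_ge0//.
Qed.

(* One of the [2 ^ d] sign vectors [e] attains [K * norm1 x = sum_i e_i * K * x_i]. *)
Lemma envelope_le_sum_exp (K : R) (x : Rd R d) :
  envelope K x <= expR K *
    \sum_(e : {ffun 'I_d -> bool}) expR (dotv (\col_i ((-1) ^+ e i * K)) (cvec x)).
Proof.
rewrite /envelope mulrDr mulr1 expRD ler_wpM2l ?expR_ge0//.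
pose e := [ffun i : 'I_d => tnth x i < 0].
rewrite (bigD1 e)//= ler_wpDr//; first by apply: sumr_ge0 => e' _; exact: expR_ge0.
rewrite ler_expR dotvE /norm1 mulr_sumr ler_sum// => i _.
by rewrite !mxE ffunE [leRHS]mulrAC [leRHS]mulrC -normrEsign.
Qed.

Lemma integrableR_envelope K : integrableR P (envelope K \o X).
Proof.
apply: (@le_integrableR _ _ _ _ _ (fun w => expR K * \sum_(e : {ffun 'I_d -> bool})
    expR (dotv (\col_i ((-1) ^+ e i * K)) (cvec (X w))))).
- exact: measurableT_comp (measurable_envelope K) _.
- by move=> w /=; rewrite ger0_norm ?envelope_ge0//; exact: envelope_le_sum_exp.
- by apply: integrableRZ; apply: integrableR_sum => e; exact: integrableR_exp_dotv.
Qed.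

Lemma integrableR_dominated (g : Rd R d -> R) C K : measurable_fun setT g ->
  (forall x, `|g x| <= C * envelope K x) -> integrableR P (g \o X).
Proof.
move=> mg gC; apply: (@le_integrableR _ _ _ _ _ (fun w => C * envelope K (X w))).
- exact: measurableT_comp.
- by move=> w; exact: gC.
- exact: integrableRZ (integrableR_envelope K).
Qed.

Variable Xs : nat -> {RV P >-> Rd R d}.
Hypothesis Xs_indep : mutually_independent P (fun j => Xs j : Omega -> Rd R d).
Hypothesis Xs_ident : forall j, identically_distributed (Xs j) X.

(** Squaring an envelope doubles its rate, so domination already provides the second moment. *)
Let ae_cvg_avg_ge0 (g : Rd R d -> R) C K : measurable_fun setT g ->
  (forall x, 0 <= g x) -> (forall x, g x <= C * envelope K x) ->
  {ae P, forall w, avg n (fun j => g (Xs j w)) @[n --> \oo] --> mean P (g \o X)}.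
Proof.
move=> mg g0 gC; apply: (ae_cvg_avg_iid_ge0 Xs_indep Xs_ident) => //.
  by apply: (integrableR_dominated (C := C) (K := K)) => // x; rewrite ger0_norm.
apply: (integrableR_dominated (g := fun x => g x ^+ 2) (C := C ^+ 2) (K := 2 * K)) => [|x].
  exact: measurable_funX.
rewrite ger0_norm ?sqr_ge0// (_ : envelope _ _ = envelope K x ^+ 2).
  by rewrite -exprMn ler_sqr ?nnegrE// (le_trans (g0 x)).
by rewrite /envelope -expRM_natl -mulrA.
Qed.

Lemma ae_cvg_avg_dominated (g : Rd R d -> R) C K : measurable_fun setT g ->
  (forall x, `|g x| <= C * envelope K x) ->
  {ae P, forall w, avg n (fun j => g (Xs j w)) @[n --> \oo] --> mean P (g \o X)}.
Proof.
move=> mg gC.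
(* Both [E] and [h] are nonnegative, and [g = h - E]. *)
pose E (x : Rd R d) := C * envelope K x; pose h x := g x + E x.
have mE : measurable_fun setT E.
  by apply: measurable_funM => //; exact: measurable_envelope.
have E0 x : 0 <= E x by exact: le_trans (gC x).
have aeE : {ae P, forall w, avg n (fun j => E (Xs j w)) @[n --> \oo] --> mean P (E \o X)}.
  exact: (ae_cvg_avg_ge0 (C := C) (K := K)).
have aeh : {ae P, forall w, avg n (fun j => h (Xs j w)) @[n --> \oo] --> mean P (h \o X)}.
  apply: (ae_cvg_avg_ge0 (C := 2 * C) (K := K)).
  - exact: measurable_funD.
  - by move=> x; have := gC x; rewrite ler_norml /h => /andP[]; rewrite -/(E x); lra.
  - by move=> x; have := gC x; rewrite ler_norml /h -mulrA => /andP[_]; rewrite -/(E x); lra.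
have gi : integrableR P (g \o X) by exact: integrableR_dominated gC.
have Ei : integrableR P (E \o X) by exact: integrableRZ (integrableR_envelope K).
apply: filterS2 aeE aeh => w wE wh.
have -> : mean P (g \o X) = mean P (h \o X) - mean P (E \o X).
  by rewrite (meanD gi Ei) addrK.
rewrite (_ : (fun n => _) = fun n => avg n (fun j => h (Xs j w)) - avg n (fun j => E (Xs j w))).
  exact: cvg_subf.
by apply/funext => n; rewrite -avgB; congr avg; apply/funext => j; rewrite addrK.
Qed.

Lemma ae_forall_countable (T : countType) (Q : T -> Omega -> Prop) :
  (forall t, {ae P, forall w, Q t w}) -> {ae P, forall w, forall t, Q t w}.
Proof.
move=> aeQ.
pose Q' (n : nat) (w : Omega) := if (choice.unpickle n : option T) is Some t then Q t w else True.
have : {ae P, forall w, forall n, Q' n w}.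
  apply: ae_foralln => n; rewrite /Q'; case: (choice.unpickle n) => [t|]; first exact: aeQ.
  exact: filterE.
by apply: filterS => w; move=> h t; have := h (choice.pickle t); rewrite /Q' choice.pickleK.
Qed.

(** Comparison with zero parameters, where the function is the constant [f 0]: the move costs [K]
    times an envelope, and the constant is absorbed because envelopes are at least 1. *)
Lemma dominated_exp_lipschitz (f : R -> R) s c : exp_lipschitz f ->
  exists C K, forall x : Rd R d, `|f (affine s c x)| <= C * envelope K x.
Proof.
move=> fL; pose K := \sum_i `|s i 0| + `|c|.
have K0 : 0 <= K by rewrite addr_ge0// sumr_ge0.
have sK i : `|s i 0| <= K.
  by rewrite /K (bigD1 i)//= -addrA lerDl addr_ge0// sumr_ge0.
have cK : `|c| <= K by rewrite lerDr sumr_ge0.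
exists (`|f 0| + K), (2 * K + 1) => x.
have h := @exp_lipschitz_affine _ _ f s 0 c 0 K K x fL sK.
have {h} : `|f (affine s c x) - f (affine 0 0 x)| <= K * envelope (2 * K + 1) x.
  apply: h => //; try (move=> i; rewrite mxE); rewrite ?normr0 ?subr0//.
have -> : affine 0 0 x = 0.
  by rewrite affineE addr0 big1// => i _; rewrite mxE mul0r.
move=> h; rewrite mulrDl -[f (affine s c x)](subrK (f 0)).
rewrite (le_trans (ler_normD _ _))// addrC lerD// ler_peMr//.
rewrite /envelope -[leLHS]expR0 ler_expR mulr_ge0// addr_ge0//; last exact: norm1_ge0.
by rewrite mulr_ge0.
Qed.

End law_of_large_numbers.

(** * Strong law with convergent parameters *)

Section uniform_law_of_large_numbers.
Context (dO : measure_display) (Omega : measurableType dO) (R : realType).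
Variables (P : probability Omega R) (d : nat) (X : {RV P >-> Rd R d}).
Hypothesis M_finite : forall t : 'cV[R]_d, (M_fune P (cvec \o X) t < +oo)%E.

Lemma integrableR_exp_lipschitz (f : R -> R) s c : measurable_fun setT f ->
  exp_lipschitz f -> integrableR P (fun w => f (affine s c (X w))).
Proof.
move=> mf fL; have [C [K fCK]] := dominated_exp_lipschitz s c fL.
apply: (integrableR_dominated M_finite (g := fun x => f (affine s c x))) fCK.
by apply: measurableT_comp => //; exact: measurable_affine.
Qed.

(* Local uniformity in the parameters of [affine]: the countably many rational
   parameters suffice, since the error made by moving the parameters by [delta]
   is at most [delta] times an average of the envelope. *)
Lemma cvg_avg_affine (f : R -> R) (x : nat -> Rd R d)
    (s_ : nat -> 'cV[R]_d) (s : 'cV[R]_d) (c_ : nat -> R) (c : R) :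
  measurable_fun setT f -> exp_lipschitz f ->
  (forall K : nat, avg n (fun j => envelope K%:R (x j)) @[n --> \oo] -->
     mean P (envelope K%:R \o X)) ->
  (forall (q : 'cV[rat]_d) (p : rat),
     avg n (fun j => f (affine (map_mx ratr q) (ratr p) (x j))) @[n --> \oo] -->
     mean P (fun w => f (affine (map_mx ratr q) (ratr p) (X w)))) ->
  (forall i, s_ n i 0 @[n --> \oo] --> s i 0) -> c_ n @[n --> \oo] --> c ->
  avg n (fun j => f (affine (s_ n) (c_ n) (x j))) @[n --> \oo] -->
  mean P (fun w => f (affine s c (X w))).
Proof.
move=> mf fL avgE avgf ss cc.
(* The extra [1] leaves room for moving every parameter by [delta <= 1] without exceeding [K]. *)
pose K := Num.Def.archi_bound (\sum_i `|s i 0| + `|c| + 1).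
have sum0 : 0 <= \sum_i `|s i 0| by apply: sumr_ge0.
have KP : \sum_i `|s i 0| + `|c| + 1 < K%:R.
  by apply: archi_boundP; rewrite !addr_ge0.
have sK i : `|s i 0| + 1 <= K%:R.
  apply: le_trans (ltW KP); rewrite lerD2r (bigD1 i)//= -addrA lerDl addr_ge0//.
  exact: sumr_ge0.
have cK : `|c| + 1 <= K%:R by apply: le_trans (ltW KP); rewrite lerD2r lerDr.
pose K' := (2 * K + 1)%N.
have K'E : K'%:R = 2 * K%:R + 1 :> R by rewrite natrD natrM.
(* The averages of the envelope converge to [C - 1], so they are eventually at most [C]. *)
pose C := mean P (envelope K'%:R \o X) + 1.
have C0 : 0 < C by rewrite ltr_wpDl// mean_ge0// => w; exact: envelope_ge0.
apply/cvgrPdist_le => e e0.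
(* Error budget: [delta * C <= e / 4] between the two means, [e / 4] for the rational parameters,
   and [2 * delta * C <= e / 2] between the averages, whose parameters both lie within [delta] of
   the limit. *)
pose delta := Num.min 1 (e / (4 * C)).
have delta0 : 0 < delta by rewrite lt_min ltr01 divr_gt0// mulr_gt0.
have delta1 : delta <= 1 by rewrite ge_min lexx.
have deltaC : delta * C <= e / 4.
  rewrite -ler_pdivlMr// -mulrA -invfM.
  by rewrite ge_min lexx orbT.
have nearK (a b : R) : `|b| + 1 <= K%:R -> `|a - b| <= delta -> `|a| <= K%:R.
  by move=> bK ab; have := ler_normD (a - b) b; rewrite subrK; lra.
have [q qs] : exists q : 'cV[rat]_d, forall i, `|ratr (q i 0) - s i 0| <= delta.
  have [q qP] := choice (fun i : 'I_d => rat_approx (s i 0) delta0).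
  by exists (\col_i q i) => i; rewrite mxE.
have [p pc] := rat_approx c delta0.
pose Q : 'cV[R]_d := map_mx ratr q; pose p' : R := ratr p.
have Qs i : `|Q i 0 - s i 0| <= delta by rewrite mxE.
have QK i : `|Q i 0| <= K%:R by exact: nearK (sK i) (Qs i).
have pK : `|p'| <= K%:R by exact: nearK cK pc.
have meanQ : `|mean P (fun w => f (affine s c (X w))) -
    mean P (fun w => f (affine Q p' (X w)))| <= delta * C.
  have i1 := integrableR_exp_lipschitz s c mf fL.
  have i2 := integrableR_exp_lipschitz Q p' mf fL.
  rewrite -(meanB i1 i2) (le_trans (le_norm_mean (integrableRB i1 i2)))//.
  apply: (@le_trans _ _ (delta * mean P (envelope K'%:R \o X))); last first.
    by rewrite ler_wpM2l ?(ltW delta0)// /C lerDl.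
  rewrite -meanZ; last exact: integrableR_envelope.
  apply: le_mean => [||w].
  - exact: integrableR_abs (integrableRB i1 i2).
  - by apply: integrableRZ; exact: integrableR_envelope.
  - rewrite K'E; apply: exp_lipschitz_affine => //; rewrite ?(distrC c)//.
    + by move=> i; have := sK i; lra.
    + by have := cK; lra.
    + by move=> i; rewrite distrC.
near=> n.
have avgQ : `|mean P (fun w => f (affine Q p' (X w))) -
    avg n (fun j => f (affine Q p' (x j)))| <= e / 4.
  by near: n; move/cvgrPdist_le : (avgf q p); apply; rewrite divr_gt0.
have avgC : avg n (fun j => envelope K'%:R (x j)) <= C.
  have : `|mean P (envelope K'%:R \o X) - avg n (fun j => envelope K'%:R (x j))| <= 1.
    by near: n; move/cvgrPdist_le : (avgE K'); apply.
  by rewrite distrC => /ler_normlP[_]; rewrite /C; lra.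
have snear i : `|s_ n i 0 - s i 0| <= delta.
  rewrite distrC; move: i; near: n; apply: filter_forall => i.
  by move/cvgrPdist_le : (ss i); apply.
have cnear : `|c_ n - c| <= delta.
  by rewrite distrC; near: n; move/cvgrPdist_le : cc; apply.
have avgs : `|avg n (fun j => f (affine Q p' (x j))) -
    avg n (fun j => f (affine (s_ n) (c_ n) (x j)))| <= 2 * delta * C.
  rewrite -avgB (le_trans (le_norm_avg _ _))//.
  apply: (@le_trans _ _ (2 * delta * avg n (fun j => envelope K'%:R (x j)))); last first.
    by rewrite ler_wpM2l// mulr_ge0// ltW.
  rewrite -avgZ; apply: le_avg => j; rewrite K'E; apply: exp_lipschitz_affine => //.
  - by move=> i; exact: nearK (sK i) (snear i).
  - exact: nearK cK cnear.
  - move=> i; rewrite -[Q i 0](subrK (s i 0)) -addrA (le_trans (ler_normD _ _))//.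
    by rewrite [(`|s i 0 - _|)]distrC mulr_natl mulr2n lerD.
  - rewrite -[p'](subrK c) -addrA (le_trans (ler_normD _ _))//.
    by rewrite [(`|c - _|)]distrC mulr_natl mulr2n lerD.
set a := mean _ _ in meanQ *; set b := mean _ _ in meanQ avgQ.
set a' := avg _ _ in avgQ avgs; set b' := avg _ _ in avgs *.
have -> : a - b' = (a - b) + (b - a') + (a' - b') by rewrite !addrA !subrK.
rewrite (le_trans (ler_normD _ _))// -[e](subrK (2 * delta * C)) lerD//; last first.
rewrite (le_trans (ler_normD _ _))//.
by move: deltaC avgQ meanQ; move: `|_| `|_| => u v; rewrite -mulrA; lra.
Unshelve. all: by end_near.
Qed.

Variable Xs : nat -> {RV P >-> Rd R d}.
Hypothesis Xs_indep : mutually_independent P (fun j => Xs j : Omega -> Rd R d).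
Hypothesis Xs_ident : forall j, identically_distributed (Xs j) X.

(** The sequences [s_] and [c_] are quantified inside the event, so they may depend on [w]. *)
Lemma ae_cvg_avg_affine (f : R -> R) : measurable_fun setT f -> exp_lipschitz f ->
  {ae P, forall w, forall (s_ : nat -> 'cV[R]_d) (s : 'cV[R]_d) (c_ : nat -> R) (c : R),
    (forall i, s_ n i 0 @[n --> \oo] --> s i 0) -> c_ n @[n --> \oo] --> c ->
    avg n (fun j => f (affine (s_ n) (c_ n) (Xs j w))) @[n --> \oo] -->
    mean P (fun w => f (affine s c (X w)))}.
Proof.
move=> mf fL.
have aeE : {ae P, forall w, forall K : nat,
    avg n (fun j => envelope K%:R (Xs j w)) @[n --> \oo] --> mean P (envelope K%:R \o X)}.
  apply: ae_foralln => K.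
  apply: (ae_cvg_avg_dominated M_finite Xs_indep Xs_ident (C := 1) (K := K%:R)).
    exact: measurable_envelope.
  by move=> x; rewrite mul1r ger0_norm// envelope_ge0.
have aef : {ae P, forall w, forall qp : 'cV[rat]_d * rat,
    avg n (fun j => f (affine (map_mx ratr qp.1) (ratr qp.2) (Xs j w))) @[n --> \oo] -->
    mean P (fun w => f (affine (map_mx ratr qp.1) (ratr qp.2) (X w)))}.
  apply: ae_forall_countable => -[q p] /=.
  have [C [K fCK]] := dominated_exp_lipschitz (map_mx ratr q) (ratr p) fL.
  apply: (ae_cvg_avg_dominated M_finite Xs_indep Xs_ident
    (g := fun x => f (affine (map_mx ratr q) (ratr p) x))) fCK.
  by apply: measurableT_comp => //; exact: measurable_affine.
apply: filterS2 aeE aef => w wE wf s_ s c_ c ss cc.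
by apply: cvg_avg_affine => // q p; exact: (wf (q, p)).
Qed.

End uniform_law_of_large_numbers.

(** * Roots of positive definite matrices *)

Lemma interpolation_poly (K : fieldType) (g : K -> K) (s : seq K) :
  exists p : {poly K}, forall x, x \in s -> p.[x] = g x.
Proof.
elim: s => [|x s [p ps]]; first by exists 0.
have [xs|xs] := boolP (x \in s).
  by exists p => y; rewrite inE => /predU1P[->|]; exact: ps.
pose q := \prod_(z <- s) ('X - z%:P).
have qx : q.[x] != 0 by rewrite -rootE root_prod_XsubC.
exists (p + ((g x - p.[x]) / q.[x]) *: q) => y.
rewrite inE hornerD hornerZ => /predU1P[->|ys]; first by rewrite divfK// subrKC.
have /rootP -> : root q y by rewrite root_prod_XsubC.
by rewrite mulr0 addr0 ps.
Qed.

Lemma trmx_horner_mx (K : comNzRingType) n (A : 'M[K]_n.+1) (p : {poly K}) :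
  A^T = A -> (horner_mx A p)^T = horner_mx A p.
Proof.
move=> AT; elim/poly_ind: p => [|p c ih]; first by rewrite rmorph0 trmx0.
rewrite rmorphD rmorphM/= horner_mx_X horner_mx_C raddfD/= tr_scalar_mx.
by rewrite trmx_mul ih AT -(comm_horner_mx p (erefl (A * A))).
Qed.

Section dotv_norm.
Variable R : realType.

Lemma dotv_ge0 n (u : 'cV[R]_n) : 0 <= dotv u u.
Proof. by rewrite dotvE sumr_ge0// => i _; rewrite -expr2 sqr_ge0. Qed.

Lemma dotv_eq0 n (u : 'cV[R]_n) : dotv u u = 0 -> u = 0.
Proof.
rewrite dotvE => /eqP; rewrite psumr_eq0; last by move=> i _; rewrite -expr2 sqr_ge0.
move=> /allP h; apply/matrixP => i j; rewrite ord1 [RHS]mxE; apply/eqP.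
by have := h i (mem_index_enum _); rewrite mulf_eq0 orbb.
Qed.

End dotv_norm.

Section posdef.
Variables (R : realType) (n : nat).
Implicit Types (S B : 'M[R]_n.+1) (u : 'cV[R]_n.+1).

Lemma posdef_eigenvalue_gt0 S (r : R) : posdefmx S -> eigenvalue S r -> 0 < r.
Proof.
move=> [ST Spos] /eigenvalueP[v vS v0].
have vT0 : v^T != 0 by apply: contra_neq v0 => /(congr1 trmx); rewrite trmxK trmx0.
have pos : 0 < dotv v^T v^T.
  by rewrite lt_neqAle dotv_ge0 andbT eq_sym; apply: contra_neq vT0 => /dotv_eq0.
have := Spos _ vT0.
have -> : S *m v^T = r *: v^T by rewrite -[in LHS]ST -trmx_mul vS linearZ.
by rewrite /dotv -scalemxAr mxE pmulr_lgt0.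
Qed.

(* A polynomial [q] with [q(r) = r^(-1/4)] on the spectrum of [S]. *)
Lemma posdef_fourth_root S : posdefmx S ->
  exists Q : 'M[R]_n.+1, Q^T = Q /\ Q * Q * (Q * Q) * S = 1.
Proof.
move=> Spos; have [ST _] := Spos.
(* The spectral theorem is used over [R[i]]; the interpolating polynomial has real coefficients, so
   the resulting identity descends along the injection [f]. *)
pose f : {rmorphism R -> R[i]} := real_complex R; pose M := map_mx f S.
have Mherm : M \is hermsymmx.
  apply: realsym_hermsym.
    by apply/is_hermitianmxP; rewrite expr0 scale1r map_mx_id// /M map_trmx ST.
  by apply/mxOverP => i j; rewrite mxE complex_real.
pose P := spectralmx M; pose D := spectral_diag M.
have MPD : M = invmx P *m diag_mx D *m P.
  exact/orthomx_spectralP/hermitian_normalmx.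
have Punit : P \in unitmx := spectral_unit M.
pose r i : R := complex.Re (D 0 i).
have rD i : f (r i) = D 0 i.
  by apply: RRe_real; exact: (mxOverP (hermitian_spectral_diag_real Mherm)).
have r0 i : 0 < r i.
  apply: (posdef_eigenvalue_gt0 Spos).
  rewrite eigenvalue_root_char -(fmorph_root f) map_char_poly -eigenvalue_root_char rD.
  (* Row [i] of [P] is a left eigenvector of [M], nonzero because [P] is invertible. *)
  apply/eigenvalueP; exists (row i P); last first.
    apply: contraTneq Punit => Pi0; rewrite -row_free_unit.
    apply/negP => /row_freeP[W PW]; have := congr1 (row i) PW.
    rewrite row_mul Pi0 mul0mx => /rowP/(_ i)/eqP.
    by rewrite !mxE eqxx eq_sym oner_eq0.
  rewrite -/M [in LHS]MPD -row_mul !mulmxA mulmxV// mul1mx row_mul row_diag_mx.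
  by rewrite -scalemxAl -rowE.
have [q qr] := interpolation_poly (fun x => (Num.sqrt (Num.sqrt x))^-1)
  [seq r i | i <- enum 'I_n.+1].
(* The claim is [p(S) = 0]; since [M] is diagonalizable, it is enough that [p] vanishes at each
   eigenvalue. *)
pose p := q * q * (q * q) * 'X - 1.
have pr i : p.[r i] = 0.
  rewrite /p !(hornerD, hornerN, hornerM, hornerX, hornerC) qr; last first.
    by apply: map_f; rewrite mem_enum.
  have := r0 i; move: (r i) => x x0.
  have : 0 < Num.sqrt (Num.sqrt x) by rewrite !sqrtr_gt0.
  have : x = Num.sqrt (Num.sqrt x) ^+ 2 ^+ 2 by rewrite !sqr_sqrtr ?sqrtr_ge0 ?ltW.
  by move: (Num.sqrt (Num.sqrt x)) => s -> s0; field; rewrite gt_eqF.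
exists (horner_mx S q); split; first exact: trmx_horner_mx.
suff : horner_mx S p = 0.
  by rewrite /p rmorphB rmorph1 !rmorphM/= horner_mx_X => /eqP; rewrite subr_eq0 => /eqP.
apply: (map_mx_inj (f := f)); rewrite map_mx0 map_horner_mx -/M MPD.
rewrite (mxpoly.horner_mx_uconjC _ (diag_mx D) Punit) horner_mx_diag.
rewrite (_ : map_mx _ _ = 0) ?raddf0 ?mulmx0 ?mul0mx//.
apply/matrixP => i j; rewrite ord1 !mxE -rD horner_map/= pr.
exact: rmorph0.
Qed.

End posdef.

(** * Coercivity and stability of the square root *)

Section quadratic_forms.
Variable R : realType.

Lemma dotv_trmx m n (A : 'M[R]_(m, n)) (u : 'cV[R]_m) v :
  dotv u (A *m v) = dotv (A^T *m u) v.
Proof. by rewrite /dotv trmx_mul trmxK mulmxA. Qed.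

Lemma dotv_mulmxE n (A : 'M[R]_n) (u : 'cV[R]_n) :
  dotv u (A *m u) = \sum_i \sum_j A i j * (u i 0 * u j 0).
Proof.
rewrite dotvE; apply: eq_bigr => i _; rewrite mxE mulr_sumr; apply: eq_bigr => j _.
by rewrite mulrCA.
Qed.

Lemma norm_quadratic_le n (E : 'M[R]_n) (e : R) u : (forall i j, `|E i j| <= e) ->
  `|dotv u (E *m u)| <= e * n%:R * dotv u u.
Proof.
move=> Ee; rewrite dotv_mulmxE (le_trans (ler_norm_sum _ _ _))//.
have -> : e * n%:R * dotv u u =
    \sum_i \sum_j e * ((u i 0 ^+ 2 + u j 0 ^+ 2) / 2).
  rewrite [RHS](eq_bigr (fun i => e / 2 * (n%:R * u i 0 ^+ 2 + \sum_j u j 0 ^+ 2))).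
    rewrite -mulr_sumr big_split/= -mulr_sumr sumr_const card_ord -[_ *+ n]mulr_natl.
    have -> : dotv u u = \sum_i u i 0 ^+ 2 by rewrite dotvE.
    by field.
  move=> i _; rewrite -mulr_sumr -mulr_suml big_split/= sumr_const card_ord -[_ *+ n]mulr_natl.
  by field.
apply: ler_sum => i _; rewrite (le_trans (ler_norm_sum _ _ _))//.
apply: ler_sum => j _; rewrite normrM; apply: ler_pM => //.
have := sqr_ge0 (u i 0 - u j 0); have := sqr_ge0 (u i 0 + u j 0).
by rewrite ler_norml !sqrrD !sqrrN; move=> h1 h2; apply/andP; split; lra.
Qed.

(** Quantitative positivity: for symmetric [S], a lower bound [k] on the eigenvalues. *)
Definition coercive n (k : R) (S : 'M[R]_n) := forall u, k * dotv u u <= dotv u (S *m u).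

(** Algebra replaces compactness of the sphere: with [A = S^(-1/2)] and [v = A S u], one has
    [u . S u = |v|^2], while [u = A v] gives [|u|^2 = v . A^2 v <= c |v|^2] with [c] computed from
    the entries of [A^2]. *)
Lemma posdef_coercive n (S : 'M[R]_n.+1) : posdefmx S ->
  exists2 k, 0 < k & coercive k S.
Proof.
move=> Spos; have [Q [QT Q4]] := posdef_fourth_root Spos.
pose A := Q *m Q.
have AT : A^T = A by rewrite trmx_mul QT.
have AAS : A *m (A *m S) = 1%:M by rewrite mulmxA; exact: Q4.
have ASA : A *m S *m A = 1%:M by exact: mulmx1C.
pose e := \sum_i \sum_j `|(A *m A) i j|.
have e0 : 0 <= e by rewrite !sumr_ge0// => i _; rewrite sumr_ge0.
have Ae i j : `|(A *m A) i j| <= e.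
  rewrite /e (bigD1 i)//= (bigD1 j)//= -addrA lerDl addr_ge0 ?sumr_ge0// => k _.
  exact: sumr_ge0.
pose c := e * n.+1%:R + 1.
have c0 : 0 < c by rewrite ltr_wpDl// mulr_ge0.
exists c^-1 => [|u]; first by rewrite invr_gt0.
pose v := A *m S *m u.
have uE : u = A *m v by rewrite mulmxA AAS mul1mx.
have uSu : dotv u (S *m u) = dotv v v.
  by rewrite {1}uE -[in LHS]AT -dotv_trmx !mulmxA.
have uu : dotv u u <= c * dotv v v.
  rewrite uE -{1}AT -dotv_trmx mulmxA (le_trans (ler_norm _))//.
  rewrite (le_trans (norm_quadratic_le _ Ae))// ler_wpM2r ?dotv_ge0//.
  by rewrite lerDl.
by rewrite uSu mulrC ler_pdivrMr// mulrC.
Qed.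

Lemma coercive_posdef n (k : R) (S : 'M[R]_n) : 0 < k -> S^T = S -> coercive k S ->
  posdefmx S.
Proof.
move=> k0 ST kS; split=> // u u0; apply: lt_le_trans (kS u).
rewrite mulr_gt0// lt_neqAle dotv_ge0 andbT eq_sym.
by apply: contra_neq u0 => /dotv_eq0.
Qed.

Lemma posdef_unitmx n (S : 'M[R]_n.+1) : posdefmx S -> S \in unitmx.
Proof.
move=> /posdef_fourth_root[Q [_ Q4]].
by have /mulmx1_unit[] : (Q * Q * (Q * Q)) *m S = 1%:M by exact: Q4.
Qed.

Lemma invsqrtmxP n (S : 'M[R]_n.+1) : posdefmx S ->
  posdefmx (invsqrtmx S) /\ invsqrtmx S *m invsqrtmx S = invmx S.
Proof.
move=> Spos; rewrite /invsqrtmx.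
apply: (@xgetPex _ 0 [set B | posdefmx B /\ B *m B = invmx S]).
have Sunit := posdef_unitmx Spos.
have [Q [QT Q4]] := posdef_fourth_root Spos.
have {}Q4 : (Q *m Q) *m (Q *m Q) *m S = 1%:M by exact: Q4.
(* This is why a fourth root was built: [Q *m Q] equals [Q^T *m Q], so its quadratic form is
   [|Q u|^2] and positivity comes from invertibility alone. *)
exists (Q *m Q); split=> /=; last by rewrite -[RHS]mul1mx -Q4 mulmxK.
split; first by rewrite trmx_mul QT.
move=> u u0; rewrite -mulmxA dotv_trmx QT lt_neqAle dotv_ge0 andbT eq_sym.
apply: contra_neq u0 => /dotv_eq0 Qu0.
by rewrite -[u]mul1mx -(mulmx1C Q4) -!mulmxA Qu0 !mulmx0.
Qed.

(** The squared Frobenius norm. *)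
Definition sqnorm n (A : 'M[R]_n) := \sum_i \sum_j A i j ^+ 2.

Lemma sqr_le_sqnorm n (A : 'M[R]_n) i j : A i j ^+ 2 <= sqnorm A.
Proof.
rewrite /sqnorm (bigD1 i)//= (bigD1 j)//= -addrA lerDl addr_ge0 ?sumr_ge0// => k _.
  exact: sqr_ge0.
by apply: sumr_ge0 => l _; exact: sqr_ge0.
Qed.

Lemma mxtrace_sandwich n (B D : 'M[R]_n) : D^T = D ->
  \tr (D *m B *m D) = \sum_j dotv (col j D) (B *m col j D).
Proof.
move=> DT; apply: eq_bigr => i _; rewrite /dotv tr_col DT.
have -> : B *m col i D = col i (B *m D) by rewrite !colE mulmxA.
by rewrite -mulmxA [LHS]mxE [RHS]mxE; apply: eq_bigr => k _; rewrite !mxE.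
Qed.

Lemma sqnorm_trace n (D : 'M[R]_n) : D^T = D -> \sum_j dotv (col j D) (col j D) = sqnorm D.
Proof.
move=> DT; rewrite /sqnorm exchange_big; apply: eq_bigr => j _.
by rewrite dotvE; apply: eq_bigr => i _; rewrite mxE expr2.
Qed.

(* With [D = A - B], [A^2 - B^2 = A D + D B], and pairing with [D] gives
   [tr ((A^2 - B^2) D) >= tr (D B D) >= k |D|^2]. *)
Lemma sqnorm_sqrtmx_le n (k : R) (A B : 'M[R]_n) : 0 < k -> posdefmx A -> B^T = B ->
  coercive k B -> sqnorm (A - B) <= sqnorm (A *m A - B *m B) / k ^+ 2.
Proof.
move=> k0 [AT Apos] BT kB; pose D := A - B; pose E := A *m A - B *m B.
have DT : D^T = D by rewrite /D raddfB/= AT BT.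
have ED : E = A *m D + D *m B.
  by rewrite /E /D mulmxBr mulmxBl addrA subrK.
(* By cyclicity this is [tr (D A D)], the sum of the quadratic form of [A] over the columns of
   [D]. *)
have trADD : 0 <= \tr (A *m D *m D).
  rewrite -mulmxA mxtrace_mulC -mulmxA mxtrace_mulC.
  rewrite mxtrace_sandwich//; apply: sumr_ge0 => j _.
  have [->|/Apos/ltW//] := eqVneq (col j D) 0.
  by rewrite mulmx0 /dotv trmx0 mul0mx mxE.
have trDBD : k * sqnorm D <= \tr (D *m B *m D).
  by rewrite mxtrace_sandwich// -sqnorm_trace// mulr_sumr; apply: ler_sum => j _; exact: kB.
(* Young's inequality entrywise, weighted so that half of [k * sqnorm D] can be absorbed on the
   left. *)
have trED : \tr (E *m D) <= sqnorm E / (2 * k) + k / 2 * sqnorm D.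
  rewrite /sqnorm mulr_suml mulr_sumr -big_split/=; apply: ler_sum => i _.
  rewrite mxE mulr_suml mulr_sumr -big_split/=; apply: ler_sum => j _.
  have -> : D j i = D i j by rewrite -[in LHS]DT mxE.
  move: (E i j) (D i j) => x y; rewrite -subr_ge0.
  have -> : x ^+ 2 / (2 * k) + k / 2 * y ^+ 2 - x * y = (x - k * y) ^+ 2 / (2 * k).
    by field; rewrite gt_eqF.
  by rewrite divr_ge0 ?sqr_ge0// mulr_ge0// ltW.
have : k * sqnorm D <= sqnorm E / (2 * k) + k / 2 * sqnorm D.
  apply: le_trans trED; rewrite ED mulmxDl mxtraceD.
  by apply: le_trans trDBD _; rewrite lerDr.
rewrite -/D -/E ler_pdivlMr ?exprn_gt0//; move: (sqnorm D) (sqnorm E) => x y h.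
have : k * (k * x) <= k * (y / (2 * k) + k / 2 * x) by rewrite ler_pM2l.
have -> : k * (y / (2 * k) + k / 2 * x) = y / 2 + k ^+ 2 * x / 2.
  by field; rewrite gt_eqF.
by rewrite mulrA -expr2 [x * _]mulrC; lra.
Qed.

(** [invsqrtmx] is a chosen root, so uniqueness is needed; it is the stability bound with equal
    squares. *)
Lemma invsqrtmx1 n : invsqrtmx 1%:M = 1%:M :> 'M[R]_n.+1.
Proof.
have pos1 : coercive 1 (1%:M : 'M[R]_n.+1) by move=> u; rewrite mul1r mul1mx.
have [Bpos BB] := invsqrtmxP (coercive_posdef ltr01 (trmx1 _ _) pos1).
have := sqnorm_sqrtmx_le ltr01 Bpos (trmx1 _ _) pos1.
rewrite BB invmx1 mulmx1 subrr => h.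
apply/matrixP => i j; apply/eqP; rewrite -subr_eq0 -sqrf_eq0.
have -> : invsqrtmx 1%:M i j - 1%:M i j = (invsqrtmx 1%:M - 1%:M : 'M[R]_n.+1) i j.
  by rewrite !mxE.
rewrite eq_le sqr_ge0 andbT (le_trans (sqr_le_sqnorm _ _ _))// (le_trans h)//.
rewrite /sqnorm big1 ?mul0r// => k _; rewrite big1// => l _.
by rewrite mxE expr0n.
Qed.

End quadratic_forms.

(** * Entrywise limits of inverses and inverse square roots *)

Section matrix_limits.
Context {R : realType} {T : Type} (F : set_system T) {FF : ProperFilter F}.

Definition mx_cvg m n (A : T -> 'M[R]_(m, n)) (B : 'M[R]_(m, n)) :=
  forall i j, A x i j @[x --> F] --> B i j.

Lemma cvg_mulmx m n p (A : T -> 'M[R]_(m, n)) (B : T -> 'M[R]_(n, p)) A' B' :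
  mx_cvg A A' -> mx_cvg B B' -> mx_cvg (fun x => A x *m B x) (A' *m B').
Proof.
move=> AA' BB' i j; rewrite mxE; under eq_fun do rewrite mxE.
by apply: cvg_sumf => k; exact: cvg_mulf.
Qed.

Lemma cvg_subfmx m n (A B : T -> 'M[R]_(m, n)) A' B' :
  mx_cvg A A' -> mx_cvg B B' -> mx_cvg (fun x => A x - B x) (A' - B').
Proof.
move=> AA' BB' i j; rewrite !mxE; under eq_fun do rewrite !mxE.
exact: cvg_subf.
Qed.

Lemma cvg_det n (A : T -> 'M[R]_n) B : mx_cvg A B -> \det (A x) @[x --> F] --> \det B.
Proof.
move=> AB; apply: cvg_sumf => s; apply: cvg_mulf; first exact: cvg_cst.
by apply: cvg_prodf => i; exact: AB.
Qed.

(** Cramer's formula writes the inverse through determinants. It describes [invmx (A x)] only where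
    [A x] is invertible, which holds eventually. *)
Lemma cvg_invmx n (A : T -> 'M[R]_n) B : B \in unitmx -> mx_cvg A B ->
  mx_cvg (fun x => invmx (A x)) (invmx B).
Proof.
move=> Bunit AB i j.
have detB : \det B != 0 by rewrite -unitfE -unitmxE.
have detA := cvg_det AB.
have lim : (\det (A x))^-1 * (\adj (A x)) i j @[x --> F] --> invmx B i j.
  rewrite /invmx Bunit mxE; apply: cvg_mulf; first exact: cvgV.
  rewrite mxE; under eq_fun do rewrite mxE.
  apply: cvg_mulf; first exact: cvg_cst.
  by apply: cvg_det => k l; rewrite !mxE; under eq_fun do rewrite !mxE; exact: AB.
have detA0 : \forall x \near F, \det (A x) != 0 by exact: (cvgr_neq0 _ detA detB).
apply: cvg_trans lim; apply: near_eq_cvg; apply: filterS detA0 => x detA0.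
have Aunit : A x \in unitmx by rewrite unitmxE unitfE.
by rewrite /invmx Aunit [in RHS]mxE.
Qed.

Lemma near_posdef n (S_ : T -> 'M[R]_n.+1) S : (forall x, (S_ x)^T = S_ x) ->
  posdefmx S -> mx_cvg S_ S -> \forall x \near F, posdefmx (S_ x).
Proof.
move=> ST Spos SS; have [k k0 kS] := posdef_coercive Spos.
(* Entrywise errors up to [e] change the quadratic form by at most [k / 2] times [|u|^2], leaving
   coercivity [k / 2]. *)
pose e := k / (2 * n.+1%:R).
have e0 : 0 < e by rewrite divr_gt0// mulr_gt0.
have close : \forall x \near F, forall i j, `|(S_ x - S) i j| <= e.
  apply: filter_forall => i; apply: filter_forall => j.
  have /cvgrPdist_le/(_ e e0) := SS i j; apply: filterS => x.
  by rewrite !mxE distrC.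
apply: filterS close => x close.
apply: (@coercive_posdef _ _ (k / 2)) => //; first by rewrite divr_gt0.
move=> u; have := norm_quadratic_le u close; have := kS u.
have -> : dotv u (S_ x *m u) = dotv u (S *m u) + dotv u ((S_ x - S) *m u).
  by rewrite /dotv -[in LHS](subrKC S (S_ x)) mulmxDl mulmxDr mxE.
have -> : e * n.+1%:R = k / 2.
  have : (n.+1%:R : R) != 0 by rewrite pnatr_eq0.
  by rewrite /e; move: (n.+1%:R : R) => N N0; field.
rewrite ler_norml => h1 /andP[h2 _]; move: h1 h2.
by move: (dotv u u) => z; lra.
Qed.

(** The stability bound uses the coercivity of the limiting root only, so no uniform lower bound
    along [S_] has to be found: the distance of the roots is controlled by that of the inverses. *)
Lemma cvg_invsqrtmx n (S_ : T -> 'M[R]_n.+1) S : (forall x, (S_ x)^T = S_ x) ->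
  posdefmx S -> mx_cvg S_ S -> mx_cvg (fun x => invsqrtmx (S_ x)) (invsqrtmx S).
Proof.
move=> ST Spos SS i j.
have [Bpos BB] := invsqrtmxP Spos; set B := invsqrtmx S in Bpos BB *.
have [k k0 kB] := posdef_coercive Bpos.
pose dist x := sqnorm (invmx (S_ x) - invmx S) / k ^+ 2.
have dist0 : dist x @[x --> F] --> (0 : R).
  rewrite -(mul0r (k ^- 2)); apply: cvg_mulf; last exact: cvg_cst.
  have -> : 0 = sqnorm (invmx S - invmx S).
    by rewrite subrr /sqnorm big1// => ? _; rewrite big1// => ? _; rewrite mxE expr0n.
  have diff : mx_cvg (fun x => invmx (S_ x) - invmx S) (invmx S - invmx S).
    apply: cvg_subfmx; last by move=> ? ?; exact: cvg_cst.
    by apply: cvg_invmx => //; exact: posdef_unitmx.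
  apply: cvg_sumf => k'; apply: cvg_sumf => l; rewrite expr2; under eq_fun do rewrite expr2.
  by apply: cvg_mulf; exact: diff.
have near_le : \forall x \near F, `|B i j - invsqrtmx (S_ x) i j| <= Num.sqrt (dist x).
  have := near_posdef ST Spos SS; apply: filterS => x Sxpos.
  have [Apos AA] := invsqrtmxP Sxpos.
  rewrite -sqrtr_sqr ler_wsqrtr// -sqrrN opprB.
  have := sqnorm_sqrtmx_le k0 Apos Bpos.1 kB; rewrite AA BB; apply: le_trans.
  by apply: le_trans (sqr_le_sqnorm _ i j); rewrite !mxE.
have sqrt_dist0 : Num.sqrt (dist x) @[x --> F] --> (0 : R).
  by rewrite -[X in _ --> X]sqrtr0; exact: (cvg_comp _ _ dist0 (@sqrt_continuous R 0)).
apply/cvgrPdist_le => e e0.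
move/cvgrPdist_le : sqrt_dist0 => /(_ e e0); apply: filterS2 near_le => x h1.
by rewrite sub0r normrN ger0_norm ?sqrtr_ge0//; exact: le_trans.
Qed.

End matrix_limits.

(** * Hyperplanes are Lebesgue null *)

Section hyperplanes.
Variable R : realType.

Definition hyperplane d (u : 'cV[R]_d) (c : R) : set (Rd R d) := [set x | affine u c x = 0].

Lemma measurable_hyperplane d (u : 'cV[R]_d) c : measurable (hyperplane u c).
Proof.
rewrite -[X in measurable X]setTI.
exact: (measurable_affine u c measurableT (measurable_set1 0)).
Qed.

Lemma affine_cons_pair d (u : 'cV[R]_d.+1) c a (y : Rd R d) :
  affine u c (cons_pair (a, y)) =
  affine (\col_i u (lift ord0 i) 0) (u ord0 0 * a + c) y.
Proof.
rewrite !affineE big_ord_recl [RHS]addrA [X in _ = X + _]addrC.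
congr (_ * _ + _ + _); apply: eq_bigr => i _.
by rewrite mxE /cons_pair/= tnthS.
Qed.

(** Sections over the first coordinate are hyperplanes one dimension lower, null by induction,
    unless the rest [u'] of the normal vanishes; then the set is a point times the whole space. *)
Lemma lebesgue_hyperplane d (u : 'cV[R]_d) c : u != 0 -> lebesgue R d (hyperplane u c) = 0%E.
Proof.
elim: d u c => [u c /eqP[]|d ih u c u0]; first by apply/matrixP => -[].
pose u' : 'cV[R]_d := \col_i u (lift ord0 i) 0.
have mH : measurable (cons_pair (R := R) (n := d) @^-1` hyperplane u c).
  rewrite -[X in measurable X]setTI.
  exact: (measurable_cons_pair measurableT (measurable_hyperplane u c)).
rewrite /= /lebesgue_step /pushforward.
have [u'0|u'0] := eqVneq u' 0; last first.
  rewrite /product_measure1; apply: integral0_eq => a _ /=.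
  rewrite (_ : xsection _ a = hyperplane u' (u ord0 0 * a + c)); first exact: ih.
  apply/seteqP; split => y; rewrite xsectionE /hyperplane /=; by rewrite affine_cons_pair.
have u00 : u ord0 0 != 0.
  apply: contra_neq u0 => u00; apply/matrixP => i j; rewrite ord1 mxE.
  have [k ->|->] := unliftP ord0 i; last exact: u00.
  by have /matrixP/(_ k 0) := u'0; rewrite !mxE.
rewrite (_ : _ @^-1` _ = [set - c / u ord0 0] `*` setT); last first.
  have aff a y : affine u c (cons_pair (a, y)) = u ord0 0 * a + c.
    by rewrite affine_cons_pair -/u' u'0 affineE big1 ?add0r// => i _; rewrite mxE mul0r.
  apply/seteqP; split => [[a y]|[a y]] /=; rewrite /hyperplane /= aff.
    move=> /eqP; rewrite addr_eq0 => /eqP ua; split => //.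
    by rewrite -ua mulrC mulKf.
  by move=> [-> _]; rewrite mulrC divfK// addNr.
rewrite product_measure1E//.
(* The second factor may be infinite; [0 * +oo = 0] in the extended reals. *)
by rewrite [X in (X * _)%E]lebesgue_measure_set1 mul0e.
Qed.

End hyperplanes.

(** * The covariance matrix of the population *)

Section population_covariance.
Context (dO : measure_display) (Omega : measurableType dO) (R : realType).
Variables (P : probability Omega R) (d : nat) (X : {RV P >-> Rd R d}).
Hypothesis M_finite : forall t : 'cV[R]_d, (M_fune P (cvec \o X) t < +oo)%E.

Lemma norm_tnth_le (x : Rd R d) i : `|tnth x i| <= envelope 1 x.
Proof.
rewrite /envelope mul1r; apply: le_trans (expR_ge1Dx _).
rewrite /norm1 (bigD1 i)//=; set s := \sum_(_ | _) _.
have : 0 <= s by exact: sumr_ge0.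
by lra.
Qed.

Lemma norm_tnthM_le (x : Rd R d) i j : `|tnth x i * tnth x j| <= envelope 2 x.
Proof.
have -> : envelope 2 x = envelope 1 x * envelope 1 x.
  by rewrite /envelope -expRD mul1r mulr_natl mulr2n.
by rewrite normrM ler_pM// norm_tnth_le.
Qed.

Lemma integrableR_tnth i : integrableR P (fun w => tnth (X w) i).
Proof.
apply: (integrableR_dominated M_finite (g := fun x => tnth x i) (C := 1) (K := 1)).
  exact: measurable_tnth.
by move=> x; rewrite mul1r norm_tnth_le.
Qed.

Lemma measurable_tnthM i j : measurable_fun setT (fun x : Rd R d => tnth x i * tnth x j).
Proof. by apply: measurable_funM; exact: measurable_tnth. Qed.

Lemma integrableR_tnthM i j : integrableR P (fun w => tnth (X w) i * tnth (X w) j).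
Proof.
apply: (integrableR_dominated M_finite (g := fun x => tnth x i * tnth x j) (C := 1) (K := 2)).
  exact: measurable_tnthM.
by move=> x; rewrite mul1r norm_tnthM_le.
Qed.

Lemma mean_vecE i : mean_vec P (cvec \o X) i 0 = mean P (fun w => tnth (X w) i).
Proof.
rewrite mxE unlock /mean /Rintegral; congr fine.
by apply: eq_integral => w _; rewrite /= mxE.
Qed.

Lemma cov_mxE_mean i j : cov_mx P (cvec \o X) i j =
  mean P (fun w => (tnth (X w) i - mean_vec P (cvec \o X) i 0) *
                   (tnth (X w) j - mean_vec P (cvec \o X) j 0)).
Proof.
rewrite !mean_vecE [LHS]mxE covariance.unlock !expectation.unlock.
rewrite /mean /Rintegral; congr fine.
have YE k : (fun w => ((cvec \o X) w k ord0)%:E) = (fun w => (tnth (X w) k)%:E).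
  by apply/funext => w; rewrite /= mxE.
apply: eq_integral => w _; rewrite !YE.
have cE k : tnth (X w) k = cvec (X w) k ord0 by rewrite mxE.
by rewrite !cE.
Qed.

Lemma integrableR_centeredM a b i j :
  integrableR P (fun w => (tnth (X w) i - a) * (tnth (X w) j - b)).
Proof.
rewrite (_ : (fun w => _) = fun w => tnth (X w) i * tnth (X w) j -
    (b * tnth (X w) i + a * tnth (X w) j - a * b)); last first.
  by apply/funext => w; ring.
apply: integrableRB; first exact: integrableR_tnthM.
apply: integrableRB; last exact: integrableR_cst.
by apply: integrableRD; apply: integrableRZ; exact: integrableR_tnth.
Qed.

Lemma cov_mxE i j : cov_mx P (cvec \o X) i j =
  mean P (fun w => tnth (X w) i * tnth (X w) j) -
  mean P (fun w => tnth (X w) i) * mean P (fun w => tnth (X w) j).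
Proof.
rewrite cov_mxE_mean !mean_vecE.
set a := mean P (fun w => tnth (X w) i); set b := mean P (fun w => tnth (X w) j).
rewrite (_ : (fun w => (_ - a) * _) = fun w => tnth (X w) i * tnth (X w) j -
    (b * tnth (X w) i + a * tnth (X w) j - a * b)); last first.
  by apply/funext => w; ring.
have iD : integrableR P (fun w => b * tnth (X w) i + a * tnth (X w) j).
  by apply: integrableRD; apply: integrableRZ; exact: integrableR_tnth.
rewrite meanB; [|exact: integrableR_tnthM|apply: integrableRB => //; exact: integrableR_cst].
rewrite meanB; [|exact: iD|exact: integrableR_cst].
rewrite meanD; [|exact: integrableRZ (integrableR_tnth _)..].
rewrite mean_cst !meanZ; [|exact: integrableR_tnth..].
by rewrite -/a -/b; ring.
Qed.

Hypothesis X_abs_cont : distribution P X `<< lebesgue R d.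

(** The form at [u] is the second moment of [u . (X - m)]. If it vanished, [X] would lie almost
    surely in a hyperplane, which is null for Lebesgue measure and so for the law of [X]. *)
Lemma cov_mx_posdef : posdefmx (cov_mx P (cvec \o X)).
Proof.
split.
  apply/matrixP => i j; rewrite mxE !cov_mxE mulrC; congr (mean P _ - _).
  by apply/funext => w; rewrite mulrC.
move=> u u0; set m := mean_vec P (cvec \o X).
pose c := - dotv u m.
have affE w : affine u c (X w) = \sum_i u i 0 * (tnth (X w) i - m i 0).
  rewrite affineE /c dotvE -sumrN -big_split/=.
  by apply: eq_bigr => i _; rewrite mulrBr.
have sqE : (fun w => affine u c (X w) ^+ 2) = (fun w => \sum_i \sum_j
    u i 0 * u j 0 * ((tnth (X w) i - m i 0) * (tnth (X w) j - m j 0))).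
  apply/funext => w; rewrite expr2 affE mulr_suml; apply: eq_bigr => i _.
  by rewrite mulr_sumr; apply: eq_bigr => j _; rewrite mulrACA.
have ii i j : integrableR P (fun w =>
    u i 0 * u j 0 * ((tnth (X w) i - m i 0) * (tnth (X w) j - m j 0))).
  by apply: integrableRZ; exact: integrableR_centeredM.
have sqi : integrableR P (fun w => affine u c (X w) ^+ 2).
  by rewrite sqE; do 2 apply: integrableR_sum => ?; exact: ii.
have -> : dotv u (cov_mx P (cvec \o X) *m u) = mean P (fun w => affine u c (X w) ^+ 2).
  rewrite dotv_mulmxE sqE mean_sum; last by move=> i; apply: integrableR_sum => j; exact: ii.
  apply: eq_bigr => i _; rewrite mean_sum; last by move=> j; exact: ii.
  apply: eq_bigr => j _; rewrite meanZ; last exact: integrableR_centeredM.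
  by rewrite cov_mxE_mean mulrC.
rewrite lt_neqAle mean_ge0 ?andbT; last by move=> w; exact: sqr_ge0.
apply/negP => /eqP mean0.
have PH0 : P (X @^-1` hyperplane u c) = 0%E.
  have /null_content_dominatesP dom := X_abs_cont.
  exact: (dom _ (measurable_hyperplane u c) (lebesgue_hyperplane c u0)).
have aff0 : ae_eq P setT (fun w => (affine u c (X w) ^+ 2)%:E) (cst 0%E).
  apply/ae_eq_integral_abs => //.
    by apply/measurable_EFinP; exact: integrableR_measurable sqi.
  under eq_integral => w _ do rewrite gee0_abs ?lee_fin ?sqr_ge0//.
  by rewrite -EFin_mean// -mean0.
have : {ae P, forall w, False}.
  have aeH : {ae P, forall w, ~ hyperplane u c (X w)}.
    exists (X @^-1` hyperplane u c); split => //.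
      rewrite -[X in measurable X]setTI.
      have mX : measurable_fun setT X by [].
      exact: (mX measurableT _ (measurable_hyperplane u c)).
    by move=> w /= /contrapT.
  apply: filterS2 aff0 aeH => w /(_ I) /= [] /eqP; rewrite sqrf_eq0 => /eqP h; exact.
move=> [N [mN N0 subN]].
have : P setT = 0%E by apply: (subset_measure0 (B := N)) => // w _; apply: subN.
by rewrite probability_setT => /eqP; rewrite onee_eq0.
Qed.

End population_covariance.

(** * Sample moments as averages, and measurability of the integrand *)

Section empirical.
Context (R : realType) (d : nat).
Variables (xs : nat -> Rd R d) (n : nat).
Let x j := cvec (xs j).

Lemma sample_meanE i : sample_mean x n i 0 = avg n (fun j => tnth (xs j) i).
Proof. by rewrite /sample_mean mxE summxE; congr (_ * _); apply: eq_bigr => j _; rewrite mxE. Qed.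

Lemma sample_covE i j : sample_cov x n i j =
  avg n (fun k => tnth (xs k) i * tnth (xs k) j) -
  avg n (fun k => tnth (xs k) i) * avg n (fun k => tnth (xs k) j).
Proof.
move Ea : (avg n (fun k => tnth (xs k) i)) => a.
move Eb : (avg n (fun k => tnth (xs k) j)) => b.
have -> : sample_cov x n i j = avg n (fun k => (tnth (xs k) i - a) * (tnth (xs k) j - b)).
  have := sample_meanE; rewrite /sample_cov; move: (sample_mean x n) => mn mnE.
  rewrite mxE summxE; congr (_ * _); apply: eq_bigr => k _.
  by rewrite mxE big_ord1 !mxE !mnE Ea Eb.
(* The average of a constant is that constant only for [n > 0]; the empty sample makes both sides
   0. *)
have [n0|n0] := eqVneq n 0%N.
  by move: Ea Eb; rewrite /avg n0 !big_ord0 => <- <-; ring.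
have avgc (r : R) : avg n (fun=> r) = r.
  by rewrite /avg sumr_const card_ord -(mulr_natl r) mulKf// pnatr_eq0.
rewrite (_ : (fun k => (_ - a) * _) = fun k => tnth (xs k) i * tnth (xs k) j -
    (b * tnth (xs k) i + a * tnth (xs k) j - a * b)); last first.
  by apply/funext => k; ring.
by rewrite !avgB avgD avgc !avgZ Ea Eb; ring.
Qed.

Lemma trmx_sample_cov : (sample_cov x n)^T = sample_cov x n.
Proof.
apply/matrixP => i j; rewrite mxE !sample_covE [X in _ - X]mulrC; congr (avg _ _ - _).
by apply/funext => k; rewrite mulrC.
Qed.

Lemma dotv_standardizedE (t m : 'cV[R]_d) (B : 'M[R]_d) (y : Rd R d) :
  dotv t (B *m (cvec y - m)) = affine (B^T *m t) (- dotv (B^T *m t) m) y.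
Proof. by rewrite dotv_trmx /affine /dotv mulmxBr !mxE. Qed.

Lemma avg_residualE (f : R -> R) t : let s := (invsqrtmx (sample_cov x n))^T *m t in
  n%:R^-1 * (\sum_(j < n) f (dotv t (residual x n j))) =
  avg n (fun j => f (affine s (- dotv s (sample_mean x n)) (xs j))).
Proof.
by congr (_ * _); apply: eq_bigr => j _; rewrite /residual dotv_standardizedE.
Qed.

Lemma dotvC (u v : 'cV[R]_d) : dotv u v = dotv v u.
Proof. by rewrite !dotvE; apply: eq_bigr => i _; rewrite mulrC. Qed.

Lemma measurable_dotv_cvec (v : 'cV[R]_d) :
  measurable_fun setT (fun u : Rd R d => dotv (cvec u) v).
Proof.
under eq_fun do rewrite dotvC -[dotv _ _]addr0.
exact: measurable_affine.
Qed.

Lemma measurable_weight gamma : measurable_fun setT (fun u : Rd R d => weight gamma (cvec u)).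
Proof.
apply: (measurableT_comp (@measurable_expR R)); apply: measurable_funM => //.
rewrite (_ : (fun u => _) = fun u : Rd R d => \sum_i tnth u i * tnth u i); last first.
  apply/funext => u; rewrite /enorm sqr_sqrtr ?dotv_ge0// dotvE.
  by apply: eq_bigr => i _; rewrite !mxE.
by apply: measurable_sum => i; apply: measurable_funM; exact: measurable_tnth.
Qed.

Lemma measurable_U_stat : measurable_fun setT (fun u : Rd R d => U_stat x n (cvec u)).
Proof.
apply: measurable_funM => //; apply: measurable_funB => //; apply: measurable_funM.
  apply: measurable_funM => //; apply: measurable_sum => j.
  apply: (measurableT_comp (continuous_measurable_fun (@continuous_cos R))).
  exact: measurable_dotv_cvec.
apply: measurable_funM => //; apply: measurable_sum => j.
by apply: (measurableT_comp (@measurable_expR R)); exact: measurable_dotv_cvec.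
Qed.

Lemma T_stat_divE gamma : (T_stat x n gamma * n%:R^-1%:E =
  \int[lebesgue R d]_u (U_stat x n (cvec u) ^+ 2 * weight gamma (cvec u) * n%:R^-1)%:E)%E.
Proof.
under [RHS]eq_integral do rewrite EFinM.
rewrite ge0_integralZr//.
- apply/measurable_EFinP; apply: measurable_funM; last exact: measurable_weight.
  by apply: measurable_funX; exact: measurable_U_stat.
- by move=> u _; rewrite lee_fin mulr_ge0 ?sqr_ge0 ?expR_ge0.
Qed.

End empirical.

(** * Pointwise limits of the integrands and Fatou's lemma *)

Section limit.
Context (R : realType) (d : nat) (dO : measure_display) (Omega : measurableType dO).
Variables (P : probability Omega R) (X : {RV P >-> Rd R d.+1}) (Xs : nat -> {RV P >-> Rd R d.+1}).
Hypothesis Xs_indep : mutually_independent P (fun j => Xs j : Omega -> Rd R d.+1).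
Hypothesis Xs_ident : forall j, identically_distributed (Xs j) X.
Hypothesis X_abs_cont : distribution P X `<< lebesgue R d.+1.
Hypothesis M_finite : forall t : 'cV[R]_d.+1, (M_fune P (cvec \o X) t < +oo)%E.

Let m := mean_vec P (cvec \o X).
Let Sigma := cov_mx P (cvec \o X).
Let s (t : 'cV[R]_d.+1) := (invsqrtmx Sigma)^T *m t.

Lemma R_fun_standardizeE t : R_fun P (standardize P (cvec \o X)) t =
  mean P (fun w => cos (affine (s t) (- dotv (s t) m) (X w))).
Proof.
rewrite /R_fun /char_fun /expectationC /= expectation.unlock /mean /Rintegral.
by congr fine; apply: eq_integral => w _; rewrite /= /standardize dotv_standardizedE.
Qed.

Lemma M_fun_standardizeE t : M_fun P (standardize P (cvec \o X)) t =
  mean P (fun w => expR (affine (s t) (- dotv (s t) m) (X w))).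
Proof.
rewrite /M_fun /M_fune expectation.unlock /mean /Rintegral.
by congr fine; apply: eq_integral => w _; rewrite /= /standardize dotv_standardizedE.
Qed.

Lemma ae_cvg_R_M_stat : {ae P, forall w, forall t : 'cV[R]_d.+1,
  R_stat (fun j => cvec (Xs j w)) n t @[n --> \oo] --> R_fun P (standardize P (cvec \o X)) t /\
  M_stat (fun j => cvec (Xs j w)) n t @[n --> \oo] --> M_fun P (standardize P (cvec \o X)) t}.
Proof.
have ae1 : {ae P, forall w, forall i : 'I_d.+1,
    avg n (fun j => tnth (Xs j w) i) @[n --> \oo] --> m i 0}.
  apply: ae_forall_countable => i; rewrite /m mean_vecE.
  apply: (ae_cvg_avg_dominated M_finite Xs_indep Xs_ident (g := fun x => tnth x i)
    (C := 1) (K := 1)).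
    exact: measurable_tnth.
  by move=> x; rewrite mul1r norm_tnth_le.
have ae2 : {ae P, forall w, forall ij : 'I_d.+1 * 'I_d.+1,
    avg n (fun j => tnth (Xs j w) ij.1 * tnth (Xs j w) ij.2) @[n --> \oo] -->
    mean P (fun w => tnth (X w) ij.1 * tnth (X w) ij.2)}.
  apply: ae_forall_countable => -[i j].
  apply: (ae_cvg_avg_dominated M_finite Xs_indep Xs_ident
    (g := fun x => tnth x i * tnth x j) (C := 1) (K := 2)).
    exact: measurable_tnthM.
  by move=> x; rewrite mul1r norm_tnthM_le.
(* The boolean index puts the cosine and the exponential into one almost sure event. *)
have aef : {ae P, forall w, forall b : bool, let f := if b then cos else @expR R in
    forall (s_ : nat -> 'cV[R]_d.+1) (s : 'cV[R]_d.+1) (c_ : nat -> R) (c : R),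
    (forall i, s_ n i 0 @[n --> \oo] --> s i 0) -> c_ n @[n --> \oo] --> c ->
    avg n (fun j => f (affine (s_ n) (c_ n) (Xs j w))) @[n --> \oo] -->
    mean P (fun w => f (affine s c (X w)))}.
  apply: ae_forall_countable => -[]; apply: ae_cvg_avg_affine => //.
  - exact: continuous_measurable_fun (@continuous_cos R).
  - exact: exp_lipschitz_cos.
  - exact: exp_lipschitz_expR.
apply: filterS3 ae1 ae2 aef => w w1 w2 wf t.
pose x j := cvec (Xs j w).
have mm : mx_cvg \oo (fun n => sample_mean x n) m.
  move=> i j; rewrite ord1; under eq_fun do rewrite sample_meanE; exact: w1.
have SS : mx_cvg \oo (fun n => sample_cov x n) Sigma.
  move=> i j; under eq_fun do rewrite sample_covE.
  rewrite /Sigma (cov_mxE M_finite) -(mean_vecE X i) -(mean_vecE X j) -/m.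
  by apply: cvg_subf; [exact: (w2 (i, j))|apply: cvg_mulf; exact: w1].
have BB := cvg_invsqrtmx (fun n => trmx_sample_cov _ n) (cov_mx_posdef M_finite X_abs_cont) SS.
pose s_ n := (invsqrtmx (sample_cov x n))^T *m t.
have ss : mx_cvg \oo s_ (s t).
  apply: cvg_mulmx; last by move=> i j; exact: cvg_cst.
  by move=> i j; rewrite mxE; under eq_fun do rewrite mxE; exact: BB.
have cc : - dotv (s_ n) (sample_mean x n) @[n --> \oo] --> - dotv (s t) m.
  apply: cvg_oppf; rewrite dotvE; under eq_fun do rewrite dotvE.
  by apply: cvg_sumf => i; apply: cvg_mulf; [exact: ss|exact: mm].
split.
  rewrite R_fun_standardizeE; under eq_fun do rewrite /R_stat avg_residualE.
  by apply: (wf true _ _ _ _ _ cc) => i; exact: ss.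
rewrite M_fun_standardizeE; under eq_fun do rewrite /M_stat avg_residualE.
by apply: (wf false _ _ _ _ _ cc) => i; exact: ss.
Qed.

Lemma ae_limit_functional_le (gamma : R) : {ae P, forall w,
  (limit_functional P (standardize P (cvec \o X)) gamma <=
   limn_einf (fun n => T_stat (fun j => cvec (Xs j w)) n gamma * (n%:R^-1)%:E))%E}.
Proof.
apply: filterS ae_cvg_R_M_stat => w RM.
pose x j := cvec (Xs j w).
pose f n (u : Rd R d.+1) := (U_stat x n (cvec u) ^+ 2 * weight gamma (cvec u) * n%:R^-1)%:E.
have mf n : measurable_fun setT (f n).
  apply/measurable_EFinP; apply: measurable_funM => //.
  apply: measurable_funM; last exact: measurable_weight.
  by apply: measurable_funX; exact: measurable_U_stat.
have f0 n u : setT u -> (0 <= f n u)%E.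
  move=> _; rewrite lee_fin; apply: divr_ge0; last exact: ler0n.
  by apply: mulr_ge0; [exact: sqr_ge0|exact: expR_ge0].
have := fatou (lebesgue R d.+1) measurableT mf f0.
under [X in limn_einf X]eq_fun do rewrite -T_stat_divE.
(* Fatou bounds the integral of the lower limit; since the integrands converge at every [u], that
   integral is the limit functional itself. *)
apply: le_trans; rewrite /limit_functional le_eqVlt; apply/orP; left; apply/eqP.
apply: eq_integral => u _; apply/esym.
have [Rlim Mlim] := RM (cvec u).
have flim : f n u @[n --> \oo] -->
    ((R_fun P (standardize P (cvec \o X)) (cvec u) *
      M_fun P (standardize P (cvec \o X)) (cvec u) - 1) ^+ 2 * weight gamma (cvec u))%:E.
  apply: cvg_EFin; first by apply: nearW.
  have lim : (R_stat x n (cvec u) * M_stat x n (cvec u) - 1) ^+ 2 * weight gamma (cvec u)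
      @[n --> \oo] --> (R_fun P (standardize P (cvec \o X)) (cvec u) *
      M_fun P (standardize P (cvec \o X)) (cvec u) - 1) ^+ 2 * weight gamma (cvec u).
    apply: cvg_mulf; last exact: cvg_cst.
    rewrite expr2; under eq_fun do rewrite expr2.
    by apply: cvg_mulf; apply: cvg_subf; [exact: cvg_mulf|exact: cvg_cst|
      exact: cvg_mulf|exact: cvg_cst].
  apply: cvg_trans lim; apply: near_eq_cvg; near=> n.
  (* For [n > 0] the square of the factor [sqrt n] in [U_stat] cancels the division by [n]. *)
  have n0 : (n%:R : R) != 0 by rewrite pnatr_eq0 -lt0n; near: n; exact: nbhs_infty_gt.
  rewrite /= /U_stat exprMn sqr_sqrtr//.
  by move: (_ ^+ 2) (weight _ _) => a b; field.
exact: (cvg_limn_einf_sup flim).1.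
Unshelve. all: by end_near.
Qed.

End limit.

Theorem theorem6p1 (R : realType) (d : nat) (hd : (0 < d)%N)
    (dO : measure_display) (Omega : measurableType dO)
    (P : probability Omega R)
    (X : {RV P >-> Rd R d}) (Xs : nat -> {RV P >-> Rd R d})
    (Xs_indep : mutually_independent P (fun j => Xs j : Omega -> Rd R d))
    (Xs_ident : forall j, identically_distributed (Xs j) X)
    (X_abs_cont : distribution P X `<< lebesgue R d)
    (M_finite : forall t : 'cV[R]_d, (M_fune P (cvec \o X) t < +oo)%E)
    (gamma : R) (gamma_gt0 : 0 < gamma) :
  (* general X: the right-hand side is that of the standardized vector *)
  {ae P, forall w,
    (limit_functional P (standardize P (cvec \o X)) gamma <=
     limn_einf (fun n =>
       T_stat (fun j => cvec (Xs j w)) n gamma * (n%:R^-1)%:E))%E} /\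
  (* X itself, under the normalization E X = 0, Cov X = I *)
  (mean_vec P (cvec \o X) = 0 -> cov_mx P (cvec \o X) = 1%:M ->
   {ae P, forall w,
     (limit_functional P (cvec \o X) gamma <=
      limn_einf (fun n =>
        T_stat (fun j => cvec (Xs j w)) n gamma * (n%:R^-1)%:E))%E}).
Proof.
(* The dimension is written as a successor because polynomials in a matrix are evaluated in the ring
   ['M[R]_n.+1]. *)
case: d hd X Xs Xs_indep Xs_ident X_abs_cont M_finite => // n _ {}X {}Xs.
move=> Xs_indep Xs_ident X_abs_cont M_finite.
have main := ae_limit_functional_le Xs_indep Xs_ident X_abs_cont M_finite gamma.
split; first exact: main.
move=> mean0 cov1.
have stdE : standardize P (cvec \o X) = cvec \o X.
  by apply/funext => w; rewrite /standardize mean0 cov1 invsqrtmx1 mul1mx subr0.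
by rewrite stdE in main.
Qed.
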